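(* Let $E$ be a nonempty set of cardinals contained in the interval $[\omega,\mathfrak{c}]$ with $\omega\notin E$. For each $\kappa\in E$, fix a non-zero cardinal $\mu_\kappa\le\mathfrak{c}$. Assume that either $|E|>1$, or $E=\{\kappa\}$ with $\mu_\kappa>1$. Then there exists a monothetic, pseudocompact, free subgroup $K$ of $\mathbb{T}^{\mathfrak{c}}$ such that $QW(K)=\{\omega\}\cup E$ and, for each $\kappa\in E$, $K$ has exactly $\mu_\kappa$ many proper quotient groups of weight $\kappa$.
   Context: $\mathbb{T}$ is the one-dimensional torus (circle group), $\mathbb{T}^{\mathfrak{c}}$ carries the product topology, and subgroups carry the subspace topology; $\mathfrak{c}=2^\omega$. The weight $w(X)$ of a space is the least cardinality of a base. For a precompact abelian group $G$, a quotient group is $G/N$ with $N$ a closed subgroup, with the quotient topology; it is called proper if $N$ is non-trivial; quotient groups are counted according to the closed subgroups $N$. $QW(G)=\{w(K): K \text{ is an infinite proper quotient group of } G\}$. (Precompact: for every neighborhood $U$ of the identity there is a finite set $F$ with $G=F+U$; every subgroup of $\mathbb{T}^{\mathfrak{c}}$ is precompact.) A topological group is monothetic if it has a dense cyclic subgroup. A space is pseudocompact if every continuous real-valued function on it is bounded. ''Free'' means free abelian as an abstract group. *)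

(* Defs.v *)
From HB Require Import structures.
From mathcomp Require Import all_boot all_order all_algebra.
From mathcomp Require Import all_classical all_reals.
From mathcomp Require Import topology normedtype.

Set Implicit Arguments.
Unset Strict Implicit.
Unset Printing Implicit Defensive.

Import Order.TTheory GRing.Theory Num.Theory.
Import numFieldNormedType.Exports.

Local Open Scope classical_set_scope.
Local Open Scope ring_scope.
Local Open Scope card_scope.

(* A cardinal is represented by a set (of any type), up to equipotence [#=]. *)

Definition card_lt T U (A : set T) (B : set U) : bool :=
  (A #<= B) && ~~ (B #<= A).
Notation "A '#<' B" := (card_lt A B) (at level 79) : card_scope.

Definition continuum : set (nat -> bool) := [set: nat -> bool].

(* The one-dimensional torus, as the quotient R / Z. *)

Definition Zsub (R : realType) : {pred R} := fun x => x \is a Num.int.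

Lemma Zsub_zmod_closed (R : realType) : zmod_closed (@Zsub R).
Proof. by split=> [|x y xZ yZ]; [exact: rpred0 | exact: rpredB]. Qed.

HB.instance Definition _ (R : realType) :=
  GRing.isZmodClosed.Build R (@Zsub R) (@Zsub_zmod_closed R).

Definition torus (R : realType) : Type := Quotient.quot (@Zsub R).
HB.instance Definition _ (R : realType) :=
  Topological.copy (torus R) (quotient_topology (Quotient.quot (@Zsub R))).
(* The group law is that of [Quotient.quot]; it is not copied from there, as
   the Choice structure it comes with differs from the topological one. *)
HB.instance Definition _ (R : realType) :=
  GRing.isZmodule.Build (torus R)
    (@addrA (Quotient.quot (@Zsub R))) (@addrC (Quotient.quot (@Zsub R)))
    (@add0r (Quotient.quot (@Zsub R))) (@addNr (Quotient.quot (@Zsub R))).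

Definition torus_power (R : realType) (I : Type) : Type := {ptws I -> torus R}.
HB.instance Definition _ (R : realType) (I : Type) :=
  Topological.copy (torus_power R I)
    {ptws I -> (torus R : topologicalType)}.
HB.instance Definition _ (R : realType) (I : Type) :=
  GRing.Zmodule.copy (torus_power R I) (I -> torus R).

(* [PreTopologicalZmodule.type] does not require the group operations to be
   continuous; it is meant to be applied to subgroups of powers of the
   torus, where they are. *)

Section subgroup.
Variables (G : PreTopologicalZmodule.type) (H : zmodClosed G).

Definition subgroup_type : Type := {x : G | x \in H}.

HB.instance Definition _ := SubChoice.on subgroup_type.
HB.instance Definition _ := [SubChoice_isSubZmodule of subgroup_type by <:].
HB.instance Definition _ :=
  Topological.copy subgroup_type
    (initial_topology (\val : subgroup_type -> G)).

End subgroup.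

Definition has_weight (X : topologicalType) U (k : set U) : Prop :=
  (exists2 B : set (set X), basis B & B #= k) /\
  (forall B : set (set X), basis B -> k #<= B).

Section groups.
Variable G : PreTopologicalZmodule.type.

Definition quotient_group (N : zmodClosed G) : topologicalType :=
  quotient_topology (Quotient.quot N).

Definition proper_kernel (N : zmodClosed G) : Prop :=
  closed [set` N] /\ [set` N] <> [set 0].

Definition QW U (k : set U) : Prop :=
  exists N : zmodClosed G, [/\ proper_kernel N,
    infinite_set [set: quotient_group N] & has_weight (quotient_group N) k].

(* The underlying sets of the subgroups, as distinct terms of type
   [zmodClosed G] could have the same elements. *)
Definition proper_quotients_of_weight U (k : set U) : set (set G) :=
  [set [set` N] | N in
    [set N : zmodClosed G |
      proper_kernel N /\ has_weight (quotient_group N) k]].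

Definition monothetic : Prop :=
  exists x : G, dense (range (fun n : int => x *~ n)).

End groups.

Arguments QW G [U] k.
Arguments proper_quotients_of_weight G [U] k.

Definition pseudocompact (R : realType) (X : topologicalType) : Prop :=
  forall f : X -> R, continuous f -> exists M : R, forall x, `|f x| <= M.

(* Every element is uniquely a finite integral combination of elements of B. *)
Definition free_abelian (G : zmodType) : Prop :=
  exists B : set G, forall x : G, exists! c : G -> int,
    [/\ finite_set [set b | c b != 0], [set b | c b != 0] `<=` B
      & x = \sum_(b \in B) b *~ c b].

(* Main.v *)
From HB Require Import structures.
Require Import Defs.
From mathcomp Require Import all_boot all_order all_algebra.
From mathcomp Require Import all_classical all_reals.
From mathcomp Require Import topology normedtype.
From mathcomp Require wochoice.
From mathcomp Require Import lra.

(** Let C be the Cantor space and T the torus.  The group is generated by a family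
    of points gen c of the power of T indexed by C, where c runs over C as well.
    Fix elements t(c, x) of T that are independent over the integers
    ([independent_family]: sums of inverse factorials along the branches of the
    binary tree).  The coordinates of gen c are prescribed on a set D c and equal
    to t(c, x) for x outside of D c.  There are two kinds of sets D c.

    - Countable sets.  There are only continuum many functions from a countable
      subset of C to T, so all of them can be prescribed.  Hence the group K
      projects onto every countable subproduct, which makes it pseudocompact
      ([countably_full_pseudocompact]).
    - Pieces: pairwise disjoint proper subsets of C, mu a many of size a for each a
      in E ([ex_pieces]; E itself has at most continuum many elements because its
      members correspond to distinct initial segments of a well ordering).  On
      a piece, the prescribed value is zero.

    Let g be a nonzero element of K, that is, a combination of generators.  If
    a generator of the first kind occurs in it, then the integral relations between
    the coordinates of g involve countably many coordinates only
    ([relations_countable]).  Otherwise they involve only the coordinates in the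
    intersection of the pieces that occur ([relations_pieces]), a single piece or
    the empty set.  In particular no nontrivial combination of generators vanishes,
    so K is free.

    By Kronecker's theorem ([kronecker]), if the relations of g are supported in D,
    then the closure of the cyclic group of g contains all points that vanish on D.
    With D empty this yields a dense cyclic subgroup.  For a nontrivial closed
    subgroup N of K it leaves two cases ([closed_subgroup_cases]): either this holds
    for some countable D, and then K/N is second countable ([quotient_basis]), or N
    is exactly the annihilator of a piece A, and then K/N has the weight of A
    ([uncountable_weight], which needs that the square of an infinite cardinal is
    itself, [card_setX_le]).

    Kronecker's theorem is derived from a duality statement: on a compact group,
    a character that vanishes on the kernel of another one is a multiple of it
    ([cchar_multiple]); by induction, a character of a closed subgroup of the power
    that vanishes where finitely many coordinates vanish is an integral combination
    of these coordinates ([cchar_combination]). *)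

Set Implicit Arguments.
Unset Strict Implicit.
Unset Printing Implicit Defensive.

Import Order.TTheory GRing.Theory Num.Theory.
Import numFieldNormedType.Exports.

Local Open Scope classical_set_scope.
Local Open Scope ring_scope.
Local Open Scope card_scope.

(** * Infinite cardinals *)

(** Comparison of cardinals by an injective relation, with no default value in
    the target to choose. *)
Lemma card_le_rel T U (A : set T) (B : set U) (r : T -> U -> Prop) :
    (forall x, A x -> exists2 y, B y & r x y) ->
    (forall x x' y, A x -> A x' -> r x y -> r x' y -> x = x') ->
  A #<= B.
Proof.
move=> rAB rinj; apply/card_leP/injfunPex.
have /choice[f fr] : forall x : A, exists y : B, r (val x) (val y).
  move=> [x /= /set_mem Ax]; have [y By rxy] := rAB x Ax.
  by exists (SigSub (mem_set By)).
exists f => // x x' _ _ fxx'; apply: val_inj.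
apply: (rinj _ _ (val (f x))) => //; [exact: set_valP|exact: set_valP|].
by rewrite fxx'.
Qed.

Lemma card_le_fun T U (A : set T) (B : set U) (f : T -> U) :
  (forall x, A x -> B (f x)) -> (forall x y, A x -> A y -> f x = f y -> x = y) ->
  A #<= B.
Proof.
move=> fAB finj; apply: (@card_le_rel _ _ _ _ (fun x y => f x = y)).
  by move=> x Ax; exists (f x) => //; apply: fAB.
by move=> x x' y Ax Ax' <- /esym; apply: finj.
Qed.

Lemma card_le_relP T U (A : set T) (B : set U) : A #<= B ->
  exists r : T -> U -> Prop,
    [/\ forall x, A x -> exists2 y, B y & r x y,
        forall x y, r x y -> A x /\ B y &
        forall x x' y, r x y -> r x' y -> x = x'].
Proof.
move=> /card_leP/injfunPex[f _ finj].
exists (fun x y => exists a : A, val a = x /\ val (f a) = y); split.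
- move=> x Ax; exists (val (f (SigSub (mem_set Ax)))); first exact: set_valP.
  by exists (SigSub (mem_set Ax)).
- by move=> x y [a [<- <-]]; split; exact: set_valP.
- move=> x x' y [a [<- <-]] [b [<- /val_inj fab]].
  by congr val; apply/esym/finj; rewrite ?inE.
Qed.

(** An injection given by a total function, once the target is inhabited. *)
Lemma card_le_funP T U (u0 : U) (A : set T) (B : set U) : A #<= B ->
  exists f : T -> U, (forall x, A x -> B (f x)) /\
    (forall x y, A x -> A y -> f x = f y -> x = y).
Proof.
move=> /card_le_relP[r [rA rAB rinj]].
have /choice[f fP] : forall x, exists y, A x -> B y /\ r x y.
  move=> x; have [Ax|nAx] := pselect (A x); last by exists u0.
  by have [y By rxy] := rA x Ax; exists y.
exists f; split=> [x /fP[]//|x y Ax Ay fxy].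
by apply: (rinj _ _ (f x)); [case: (fP x Ax)|rewrite fxy; case: (fP y Ay)].
Qed.

Lemma card_le_setX T T' U U' (A : set T) (A' : set T') (B : set U) (B' : set U') :
  A #<= A' -> B #<= B' -> A `*` B #<= A' `*` B'.
Proof.
move=> /card_le_relP[r [rA rAA' rI]] /card_le_relP[s [sB sBB' sI]].
apply: (@card_le_rel _ _ _ _ (fun p q => r p.1 q.1 /\ s p.2 q.2)).
  move=> [x y] [/= /rA[x' A'x' rx] /sB[y' B'y' sy]].
  by exists (x', y').
move=> [x1 y1] [x2 y2] [x y] /= _ _ [r1 s1] [r2 s2].
by rewrite (rI _ _ _ r1 r2) (sI _ _ _ s1 s2).
Qed.

Lemma well_order_lt (T : Type) : exists lt : T -> T -> Prop,
  [/\ well_founded lt, forall x y z, lt x y -> lt y z -> lt x z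
    & forall x y, [\/ lt x y, x = y | lt y x]].
Proof.
have [R woR] := wochoice.well_ordering_principle {classic T}.
have woC : wochoice.wo_chain R predT by move=> A _; apply: woR.
have Rtot : total R by move=> x y; apply: (wochoice.wo_chainW woC).
have Ranti : antisymmetric R.
  by move=> x y; apply: (wochoice.wo_chain_antisymmetric woC).
have Rmin (A : set T) : A !=set0 -> exists2 z, A z & forall x, A x -> R z x.
  move=> [a Aa].
  have [|z [[/asboolP Az zmin] _]] := woR (fun x : {classic T} => `[< A x >]).
    by exists a; apply/asboolP.
  by exists z => // x Ax; apply: zmin; apply/asboolP.
have Rtr x y z : R x y -> R y z -> R x z.
  move=> Rxy Ryz.
  have [|m Am mmin] := Rmin [set u | [\/ u = x, u = y | u = z]].
    by exists x; apply: Or31.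
  have Rmx : R m x by apply: mmin; apply: Or31.
  have Rmy : R m y by apply: mmin; apply: Or32.
  have Rmz : R m z by apply: mmin; apply: Or33.
  case: Am => E; subst m => //.
    by have -> : x = y by apply: Ranti; rewrite Rxy Rmx.
  by have <- : y = z by apply: Ranti; rewrite Ryz Rmy.
exists (fun x y => ~~ R y x); split.
- move=> a; apply: contrapT => na.
  have [|z nz zmin] := Rmin [set x | ~ Acc (fun x y => ~~ R y x) x].
    by exists a.
  apply: nz; constructor => y nRzy; apply: contrapT => /zmin.
  by rewrite (negPf nRzy).
- move=> x y z nyx nzy; apply/negP => Rzx.
  have : R x y by have := Rtot x y; rewrite (negPf nyx) orbF.
  by move=> Rxy; have := Rtr _ _ _ Rzx Rxy; rewrite (negPf nzy).
- move=> x y; have [Rxy|nRxy] := boolP (R x y); last exact: Or33.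
  have [Ryx|nRyx] := boolP (R y x); last exact: Or31.
  by apply: Or32; apply: Ranti; rewrite Rxy Ryx.
Qed.

(** Greedy injection: if no proper initial segment of a well ordered set is as
    large as S, then transfinite recursion, always choosing a fresh element of
    S, embeds the whole set in S. *)
Lemma card_le_greedy X T (lt : X -> X -> Prop) (D : set X) (S : set T) :
    well_founded lt -> (forall x y, [\/ lt x y, x = y | lt y x]) ->
    (forall x, D x -> ~ (S #<= [set y | D y /\ lt y x])) ->
  D #<= S.
Proof.
move=> wf tri nS.
have [[s0 _]|S0] := pselect (exists s, S s); last first.
  suff -> : D = set0 by apply: card_ge0.
  rewrite -subset0 => x /nS; apply.
  suff -> : S = set0 by apply: card_ge0.
  by rewrite -subset0 => s Ss; apply: S0; exists s.
pose F x (f : forall y, lt y x -> T) : T :=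
  xget (s0 : {classic T})
    (S `\` [set t | exists y (ltyx : lt y x), D y /\ t = f y ltyx]).
pose f := Fix wf (fun=> T) F.
have fE x : f x = xget (s0 : {classic T})
    (S `\` [set t | exists2 y, D y /\ lt y x & t = f y]).
  rewrite /f Fix_eq; last first.
    move=> y g g' gg'; congr F; apply: functional_extensionality_dep => z.
    by apply: functional_extensionality_dep => lt_zy; apply: gg'.
  rewrite /F; apply: (congr1 (xget (s0 : {classic T}))).
  apply/seteqP; split=> t [St nt]; split=> //.
    by move=> [y [Dy ltyx] ty]; apply: nt; exists y, ltyx.
  by move=> [y [ltyx [Dy ty]]]; apply: nt; exists y.
have fP x : D x -> S (f x) /\ ~ exists2 y, D y /\ lt y x & f x = f y.
  move=> Dx; rewrite {1}fE; set Q := (_ `\` _).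
  suff : Q (xget (s0 : {classic T}) Q) by rewrite -fE; case.
  apply: xgetPex; apply: contrapT => nQ; apply: (nS x Dx).
  have SQ t : S t -> exists2 y, D y /\ lt y x & t = f y.
    by move=> St; apply: contrapT => nt; apply: nQ; exists t.
  apply: (@card_le_rel _ _ _ _ (fun t y => t = f y)).
    by move=> t /SQ[y ? ->]; exists y.
  by move=> t t' y _ _ -> ->.
apply: (card_le_fun (f := f)) => [x /fP[]//|x y Dx Dy fxy].
have [ltxy|//|ltyx] := tri x y.
  by have [_ []] := fP y Dy; exists x.
by have [_ []] := fP x Dx; exists y.
Qed.

(** The canonical ordering of pairs: first by the maximum of the two components,
    then lexicographically. *)
Definition canonical_lt T (lt : T -> T -> Prop) (p q : T * T) : Prop :=
  let mx r := if `[< lt r.1 r.2 >] then r.2 else r.1 in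
  lt (mx p) (mx q) \/
  mx p = mx q /\ (lt p.1 q.1 \/ p.1 = q.1 /\ lt p.2 q.2).

Lemma canonical_lt_wf T (lt : T -> T -> Prop) :
  well_founded lt -> well_founded (canonical_lt lt).
Proof.
move=> wf; pose mx r := if `[< lt r.1 r.2 >] then r.2 else r.1.
suff H : forall m a b r, mx r = m -> r.1 = a -> r.2 = b -> Acc (canonical_lt lt) r.
  by move=> r; apply: H erefl erefl erefl.
elim/(well_founded_ind wf) => m IHm; elim/(well_founded_ind wf) => a IHa.
elim/(well_founded_ind wf) => b IHb r rm ra rb.
constructor => q [qlt|[qm [qlt|[qa qlt]]]].
- by apply: (IHm (mx q)) erefl erefl erefl; rewrite -rm.
- by apply: (IHa q.1) erefl erefl; [rewrite -ra|rewrite -rm].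
- by apply: (IHb q.2) => //; [rewrite -rb|rewrite -rm|rewrite -ra].
Qed.

Lemma canonical_lt_total T (lt : T -> T -> Prop) :
  (forall x y, [\/ lt x y, x = y | lt y x]) ->
  forall p q, [\/ canonical_lt lt p q, p = q | canonical_lt lt q p].
Proof.
move=> tri p q; pose mx r := if `[< lt r.1 r.2 >] then r.2 else r.1.
have [h|h|h] := tri (mx p) (mx q); [by apply: Or31; left| |by apply: Or33; left].
have [h1|h1|h1] := tri p.1 q.1; [by apply: Or31; right; split=> //; left| |].
  have [h2|h2|h2] := tri p.2 q.2; [by apply: Or31; right; split=> //; right| |].
    by apply: Or32; rewrite [p]surjective_pairing h1 h2 -surjective_pairing.
  by apply: Or33; right; split=> //; right.
by apply: Or33; right; split=> //; left.
Qed.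

(** Hessenberg: an infinite set is equipotent to its square.  In the canonical
    ordering of pairs, every initial segment sits inside the square of a proper
    initial segment, so the greedy injection applies. *)
Lemma card_setTX_le T : infinite_set [set: T] -> [set: T * T] #<= [set: T].
Proof.
have [lt [wf tr tri]] := well_order_lt T.
have irr x : ~ lt x x.
  by elim/(well_founded_ind wf): x => x IH ltxx; exact: (IH x).
have key (I : set T) : (forall x y, I x -> lt y x -> I y) -> infinite_set I ->
    (forall y, I y -> infinite_set [set z | lt z y] ->
      [set z | lt z y] `*` [set z | lt z y] #<= [set z | lt z y]) ->
    I `*` I #<= I.
  move=> Idown Iinf IH.
  have [[y Iy Iley]|nle] := pselect (exists2 y, I y & I #<= [set z | lt z y]).
    have syI : [set z | lt z y] `<=` I by move=> z; apply: Idown.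
    have yinf : infinite_set [set z | lt z y].
      by move=> /(card_le_finite Iley).
    apply: card_le_trans (card_le_setX Iley Iley) _.
    by apply: card_le_trans (IH y Iy yinf) _; apply: subset_card_le.
  apply: card_le_greedy (canonical_lt_wf wf) (canonical_lt_total tri) _.
  move=> p [Ip1 Ip2] Ile.
  pose mx r := if `[< lt r.1 r.2 >] then r.2 else r.1.
  pose m := mx p.
  have Im : I m by rewrite /m /mx; case: ifP.
  pose J := [set z | lt z m \/ z = m].
  have mx1 r : lt r.1 (mx r) \/ r.1 = mx r.
    by rewrite /mx; case: asboolP => h; [left|right].
  have mx2 r : lt r.2 (mx r) \/ r.2 = mx r.
    rewrite /mx; case: asboolP => h; first by right.
    by have [//|->|] := tri r.1 r.2; [right|left].
  (* every pair below p has both components at most m *)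
  have IJ : I #<= J `*` J.
    apply: card_le_trans Ile _; apply: subset_card_le => q [_ qlt].
    have qm : lt (mx q) m \/ mx q = m by case: qlt => [|[]]; [left|right].
    split; rewrite /J /=.
      case: (mx1 q) => [h|->//]; case: qm => [h'|<-]; last by left.
      by left; apply: tr h h'.
    case: (mx2 q) => [h|->//]; case: qm => [h'|<-]; last by left.
    by left; apply: tr h h'.
  have JE : J = [set z | lt z m] `|` [set m] by apply/seteqP; split.
  have [mfin|minf] := pselect (finite_set [set z | lt z m]).
    apply: Iinf; apply: card_le_finite IJ _; apply: finite_setX; rewrite JE;
    by rewrite finite_setU; split=> //; apply: finite_set1.
  apply: nle; exists m => //; apply: card_le_trans IJ _.
  (* adding the element m to an infinite segment does not change its size *)
  have JM : J #<= [set z | lt z m].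
    have /infiniteP/(card_le_funP m)[g [gm ginj]] := minf.
    apply: (@card_le_rel _ _ _ _ (fun x y =>
      [\/ x = m /\ y = g 0%N, exists2 n, x = g n & y = g n.+1 |
          (x <> m /\ (forall n, x <> g n)) /\ y = x])).
      move=> x; have [->|xm] := pselect (x = m).
        by exists (g 0%N); [apply: gm|apply: Or31].
      move=> [|//] /= ltxm.
      have [[n xn]|nx] := pselect (exists n, x = g n).
        by exists (g n.+1); [apply: gm|apply: Or32; exists n].
      exists x => //; apply: Or33; split=> //; split=> // n xn.
      by apply: nx; exists n.
    have gi i j : g i = g j -> i = j by exact: ginj.
    move=> x x' y _ _ [[xm y0]|[n xn yn]|[[xm xg] yx]];
      move=> [[x'm y0']|[n' xn' yn']|[[xm' xg'] yx']].
    - by rewrite xm x'm.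
    - by move: yn'; rewrite y0 => /gi.
    - by have := xg' 0%N; rewrite -yx' y0.
    - by move: yn; rewrite y0' => /gi.
    - by move: yn; rewrite yn' => /gi[nn]; rewrite xn xn' nn.
    - by have := xg' n.+1; rewrite -yx' yn.
    - by have := xg 0%N; rewrite -yx y0'.
    - by have := xg n'.+1; rewrite -yx yn'.
    - by rewrite -yx -yx'.
  exact: card_le_trans (card_le_setX JM JM) (IH m Im minf).
have key2 y : infinite_set [set z | lt z y] ->
   [set z | lt z y] `*` [set z | lt z y] #<= [set z | lt z y].
  elim/(well_founded_ind wf): y => y IH yinf; apply: key => //.
  by move=> u v uy vu; exact: tr vu uy.
by move=> Tinf; rewrite -setXTT; apply: key => // y _; apply: key2.
Qed.

Lemma card_setX_le T (A : set T) : infinite_set A -> A `*` A #<= A.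
Proof.
move=> Ainf; have AinfT : infinite_set [set: A].
  by move=> h; apply: Ainf; rewrite -(eq_finite_set (card_setT A)).
rewrite -(card_le_eqr (card_setT A)).
apply: card_le_trans (card_setTX_le AinfT); rewrite -setXTT.
by apply: card_le_setX; rewrite (card_le_eqr (card_setT A)).
Qed.

Lemma card_setX_nat_le T (A : set T) : infinite_set A -> A `*` [set: nat] #<= A.
Proof.
move=> Ainf; apply: card_le_trans (card_setX_le Ainf).
by apply: card_le_setX => //; apply/infiniteP.
Qed.

(** Finite sequences in an infinite set are no more numerous than its
    elements: a sequence is determined by its size and the iterated pairing of
    its entries. *)
Lemma card_seq_le (T : eqType) (A : set T) : infinite_set A ->
  [set s : seq T | {in s, forall x, A x}] #<= A.
Proof.
move=> Ainf; have [a0 Aa0] := infinite_setN0 Ainf.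
have [f [fA finj]] := card_le_funP a0 (card_setX_le Ainf).
pose code s := foldr (fun x y => f (x, y)) a0 s.
have inA x s : {in x :: s, forall z, A z} -> A x /\ {in s, forall z, A z}.
  by move=> h; split=> [|z zs]; apply: h; rewrite inE ?eqxx // zs orbT.
have codeA s : {in s, forall x, A x} -> A (code s).
  by elim: s => //= x s IH /inA[Ax As]; apply: fA; split=> //; apply: IH.
apply: card_le_trans (card_setX_nat_le Ainf).
apply: (@card_le_fun _ _ _ _ (fun s => (code s, size s))).
  by move=> s As; split=> //; apply: codeA.
elim=> [|x s IH] [|y t] //= /inA[Ax As] /inA[Ay At] [].
move=> fE st; have [-> cst] : (x, code s) = (y, code t).
  by apply: finj => //; split=> //; apply: codeA.
by congr cons; apply: IH => //; rewrite cst st.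
Qed.

(** Every set embeddable in a well ordered type is equipotent to an initial
    segment, [None] standing for the improper one. *)
Lemma card_eq_segment T U (lt : T -> T -> Prop) (S : set U) :
    well_founded lt -> (forall x y z, lt x y -> lt y z -> lt x z) ->
    (forall x y, [\/ lt x y, x = y | lt y x]) ->
    S #<= [set: T] ->
  exists o : option T, S #= (if o is Some x then [set y | lt y x] else setT).
Proof.
move=> wf tr tri ST.
have [[x0 Sx0]|nS] := pselect (exists x, S #<= [set y | lt y x]).
  have [x [Sx xmin]] : exists x, S #<= [set y | lt y x] /\
      forall y, lt y x -> ~ (S #<= [set z | lt z y]).
    elim/(well_founded_ind wf): x0 Sx0 => x IH Sx.
    have [[y [ltyx Sy]]|ny] :=
        pselect (exists y, lt y x /\ S #<= [set z | lt z y]).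
      exact: IH ltyx Sy.
    by exists x; split=> // y ltyx Sy; apply: ny; exists y.
  exists (Some x); rewrite card_eq_le Sx /=.
  apply: card_le_greedy wf tri _ => y ltyx /card_le_trans h.
  by apply: (xmin y ltyx); apply: h; apply: subset_card_le => z [].
exists None; rewrite card_eq_le ST /=.
apply: card_le_greedy wf tri _ => y _ /card_le_trans h.
by apply: nS; exists y; apply: h; apply: subset_card_le => z [].
Qed.

(** Pairwise non-equipotent subsets of size at most |T| are at most |T| many. *)
Lemma card_le_nonequipotent T U (E : set (set U)) : infinite_set [set: T] ->
    (forall a b, E a -> E b -> a #= b -> a = b) ->
    (forall a, E a -> a #<= [set: T]) ->
  E #<= [set: T].
Proof.
move=> Tinf Eneq ET; have [lt [wf tr tri]] := well_order_lt T.
have [t0 _] := infinite_setN0 Tinf.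
apply: card_le_trans (card_setX_nat_le Tinf).
apply: (@card_le_rel _ _ _ _ (fun a p => a #=
    (if p.2 is 0%N then [set y | lt y p.1] else setT))).
  move=> a Ea; have [[x|] ax] := card_eq_segment wf tr tri (ET a Ea).
    by exists (x, 0%N).
  by exists (t0, 1%N).
move=> a b p Ea Eb ap bp; apply: Eneq => //.
by apply: card_eq_trans ap _; rewrite card_eq_sym.
Qed.

(** * The torus *)

Section torus.
Variable R : realType.
Local Notation T := (torus R).
Implicit Types (e r x y : R) (t s : T).

(** The canonical projection of the real line onto the torus. *)
Definition tpi (r : R) : T := (\pi_(Quotient.quot (@Zsub R)) r)%qT.

Lemma tpiB x y : tpi (x - y) = tpi x - tpi y.
Proof. exact: (pi_is_zmod_morphism (Quotient.quot (@Zsub R))). Qed.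

Lemma tpi0 : tpi 0 = 0.
Proof. by rewrite -(subrr 0) tpiB subrr. Qed.

Lemma tpiN x : tpi (- x) = - tpi x.
Proof. by rewrite -[- x]sub0r tpiB tpi0 sub0r. Qed.

Lemma tpiD x y : tpi (x + y) = tpi x + tpi y.
Proof. by rewrite -{1}[y]opprK tpiB tpiN opprK. Qed.

Lemma tpiMn x n : tpi (x *+ n) = tpi x *+ n.
Proof. by elim: n => [|n IH]; rewrite ?mulr0n ?tpi0// !mulrS tpiD IH. Qed.

Lemma tpiMz x (n : int) : tpi (x *~ n) = tpi x *~ n.
Proof. by case: n => n; rewrite ?NegzE ?mulrNz ?tpiN -!pmulrn tpiMn. Qed.

Lemma tpi_eqP x y : tpi x = tpi y <-> exists n : int, x = y + n%:~R.
Proof.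
have E : (tpi x = tpi y) <-> (x - y \is a Num.int).
  have -> : (x - y \is a Num.int) = (x - y \in @Zsub R) by [].
  rewrite (Quotient.idealrBE (@Zsub R)).
  by split=> [E|/eqP E]; [apply/eqP; exact: E|exact: E].
rewrite E; split=> [/intrP[n nE]|[n ->]].
  by exists n; rewrite -nE addrC subrK.
by rewrite addrC addKr intr_int.
Qed.

Lemma tpi_eq0P x : tpi x = 0 <-> exists n : int, x = n%:~R.
Proof.
by rewrite -tpi0 tpi_eqP; split=> -[n nE]; exists n; move: nE; rewrite add0r.
Qed.

Lemma tpi_surj t : exists2 r, 0 <= r < 1 & t = tpi r.
Proof.
have [r ->] : exists r, t = tpi r by exists (repr t); rewrite /tpi reprK.
exists (r - (Num.floor r)%:~R).
  by rewrite subr_ge0 floor_le ltrBlDl -intrD1 floorD1_gt.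
by apply/tpi_eqP; exists (Num.floor r); rewrite subrK.
Qed.

(** The neighbourhoods of zero in the torus: [small e t] says that t has a
    representative of absolute value below e. *)
Definition small e t := exists2 r, `|r| < e & t = tpi r.

Lemma small0 e : 0 < e -> small e 0.
Proof. by exists 0; rewrite ?normr0 ?tpi0. Qed.

Lemma smallN e t : small e t -> small e (- t).
Proof. by move=> [r re ->]; exists (- r); rewrite ?normrN ?tpiN. Qed.

Lemma smallD e1 e2 t s : small e1 t -> small e2 s -> small (e1 + e2) (t + s).
Proof.
move=> [r re ->] [r' re' ->]; exists (r + r'); rewrite ?tpiD //.
by apply: le_lt_trans (ler_normD _ _) _; apply: ltrD.
Qed.

Lemma smallW e1 e2 t : e1 <= e2 -> small e1 t -> small e2 t.
Proof. by move=> ee [r re ->]; exists r => //; apply: lt_le_trans re ee. Qed.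

Lemma small_eq0 t : (forall e, 0 < e -> small e t) -> t = 0.
Proof.
have [r /andP[r0 r1] ->] := tpi_surj t => h.
have [->|rn0] := eqVneq r 0; first exact: tpi0.
have rgt0 : 0 < r by rewrite lt_def rn0.
have [|x xe /tpi_eqP[n rE]] := h (Num.min r (1 - r)).
  by rewrite lt_min rgt0 subr_gt0.
move: xe; rewrite lt_min !ltr_norml => /andP[/andP[xr xr'] /andP[x1 x1']].
exfalso; have [n0|n0] := leP n 0.
  have : n%:~R <= 0 :> R by rewrite lerz0.
  by lra.
have : 1 <= n%:~R :> R by rewrite -[1]/(1%:~R) ler_int.
by lra.
Qed.

Lemma half_not_small : ~ small 4^-1 (tpi 2^-1).
Proof.
move=> [r r4 /tpi_eqP[n nE]]; move: r4; rewrite ltr_norml => /andP[r1 r2].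
have [n0|n0] := leP n 0.
  by have : n%:~R <= 0 :> R by [rewrite lerz0]; lra.
have : 1 <= n%:~R :> R by rewrite -[1]/(1%:~R) ler_int.
by lra.
Qed.

Lemma torus_openP (O : set T) : open O <->
  forall t, O t -> exists2 e, 0 < e & forall s, small e s -> O (t + s).
Proof.
have E : open O <-> open (tpi @^-1` O) by [].
rewrite E openE; split=> [h t|h x Ox].
  have [x _ ->] := tpi_surj t => Ox.
  have /nbhs_ballP[e e0 xe] := h x Ox.
  exists e => // s [r re ->]; rewrite -tpiD; apply: xe.
  by rewrite /ball /= opprD addrA subrr sub0r normrN.
have [e e0 he] := h _ Ox.
apply/nbhs_ballP; exists e => // y; rewrite /ball /= => xy.
rewrite -[y](subrK x) addrC tpiD; apply: he.
by exists (y - x) => //; rewrite distrC.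
Qed.

Lemma small_open e t : open [set s | small e (s - t)].
Proof.
apply/torus_openP => s [r re rE]; exists (e - `|r|); first by rewrite subr_gt0.
move=> s' s'e; rewrite /= addrAC rE -[e](subrK `|r|) addrC.
have [r' r'e ->] := s'e; rewrite -tpiD.
exists (r' + r) => //; apply: le_lt_trans (ler_normD _ _) _.
by rewrite ltrD2r.
Qed.

Lemma torus_nbhsP t (A : set T) : nbhs t A <->
  exists2 e, 0 < e & forall s, small e (s - t) -> A s.
Proof.
split=> [|[e e0 eA]].
  rewrite nbhsE => -[O [/torus_openP oO Ot] OA].
  have [e e0 he] := oO t Ot; exists e => // s /he; rewrite addrC subrK.
  exact: OA.
rewrite nbhsE; exists [set s | small e (s - t)] => //.
by split; [apply: small_open|rewrite /= subrr; apply: small0].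
Qed.

Lemma tpi_continuous : continuous tpi.
Proof. exact: (@pi_continuous R (Quotient.quot (@Zsub R))). Qed.

Lemma torus_compact : compact [set: T].
Proof.
have -> : [set: T] = tpi @` `[0, 1].
  apply/seteqP; split=> // t _; have [r /andP[r0 r1] ->] := tpi_surj t.
  by exists r => //=; rewrite in_itv /= r0 ltW.
apply: continuous_compact; last exact: segment_compact.
by apply: continuous_subspaceT; apply: tpi_continuous.
Qed.

(** The torus has no small subgroups. *)
Lemma no_small_multiples t : (forall n, small 3^-1 (t *+ n)) -> t = 0.
Proof.
move=> h; suff H k : small (3^-1 / 2 ^+ k) t.
  apply: small_eq0 => e e0.
  have [k ke] : exists k, 3^-1 / 2 ^+ k <= e.
    exists (Num.bound (e^-1)).
    have P0 : 0 < 2 ^+ Num.bound e^-1 :> R by rewrite exprn_gt0.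
    have eP : e^-1 < 2 ^+ Num.bound e^-1.
      apply: lt_le_trans (archi_boundP _) _; first by rewrite invr_ge0 ltW.
      by rewrite -natrX ler_nat ltnW // ltn_expl.
    have {}eP : (2 ^+ Num.bound e^-1)^-1 < e by rewrite invf_plt ?posrE.
    apply: le_trans (ltW eP); rewrite ler_piMl ?invr_ge0 ?ltW //.
    by lra.
  exact: smallW ke (H k).
elim: k t h => [|k IH] t h; first by rewrite expr0 divr1; have := h 1%N.
have [r re tr] := h 1%N.
have /IH[r' r'e t2] : forall n, small 3^-1 (t *+ 2 *+ n).
  by move=> n; rewrite -mulrnA.
rewrite mulr1n in tr.
exists r => //.
have r'3 : `|r'| < 3^-1.
  apply: lt_le_trans r'e _; rewrite ler_pdivrMr ?exprn_gt0 //.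
  rewrite ler_peMr ?invr_ge0 //.
  by rewrite -natrX ler1n expn_gt0.
have [n nE] : exists n : int, r *+ 2 = r' + n%:~R.
  by apply/tpi_eqP; rewrite tpiMn -tr t2.
have n0 : n = 0.
  move: re r'3; rewrite !ltr_norml => /andP[r1 r2] /andP[r3 r4].
  have [n1|n1|//] := ltrgt0P n.
    have : 1 <= n%:~R :> R by rewrite -[1]/(1%:~R) ler_int.
    move=> n1'; exfalso; move: nE; rewrite mulr2n; lra.
  have : n%:~R <= -1 :> R by rewrite -[-1]/((-1)%:~R) ler_int -ltzD1.
  by move=> n1'; exfalso; move: nE; rewrite mulr2n; lra.
have {}nE : r' = r * 2 by rewrite mulr_natr nE n0 addr0.
move: r'e; rewrite nE normrM (gtr0_norm (_ : 0 < 2 :> R)) //.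
by rewrite -ltr_pdivlMr // exprS invfM [2^-1 * _]mulrC mulrA.
Qed.

Lemma torus_closedP (S : set T) : closed S ->
  forall t, (forall e, 0 < e -> exists2 s, S s & small e (s - t)) -> S t.
Proof.
move=> cS t h; apply: cS => A /torus_nbhsP[e e0 eA].
by have [s Ss se] := h e e0; exists s; split=> //; apply: eA.
Qed.

(** A proper closed subgroup of the torus is finite, hence of finite exponent. *)
Lemma torus_closed_subgroup (S : set T) : closed S -> S 0 ->
    (forall s t, S s -> S t -> S (s - t)) ->
  S = setT \/ exists2 q, (0 < q)%N & forall s, S s -> s *+ q = 0.
Proof.
move=> cS S0 SB.
have SN s : S s -> S (- s) by move=> Ss; rewrite -sub0r; apply: SB.
have SD s t : S s -> S t -> S (s + t).
  by move=> Ss St; rewrite -[t]opprK; apply: SB => //; apply: SN.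
have SM s n : S s -> S (s *+ n).
  by move=> Ss; elim: n => [|n IH]; rewrite ?mulr0n// mulrS; apply: SD.
have [[d d0 dS]|nd] := pselect (exists2 d, 0 < d & forall s, S s -> small d s -> s = 0).
  right; pose N := (Num.bound d^-1).+1.
  have N0 : 0 < N%:R :> R by rewrite ltr0n.
  have Nd : N%:R^-1 < d.
    rewrite invf_plt ?posrE //; apply: lt_le_trans (archi_boundP _) _.
      by rewrite invr_ge0 ltW.
    by rewrite ler_nat.
  exists N`!; first exact: fact_gt0.
  move=> s Ss.
  have /choice[r rP] : forall j : nat, exists r, 0 <= r < 1 /\ s *+ j = tpi r.
    by move=> j; have [r] := tpi_surj (s *+ j); exists r.
  pose f (j : nat) := `|Num.floor (r j * N%:R)|%N.
  have fN j : (f j < N)%N.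
    have [/andP[r0 r1] _] := rP j; have h0 : 0 <= r j * N%:R by rewrite mulr_ge0.
    rewrite -(ltr_nat R) /f natr_absz ger0_norm ?floor_ge0 //.
    by apply: le_lt_trans (floor_le _) _; rewrite gtr_pMl.
  have [i [j [ij jN fij]]] : exists i j, [/\ (i < j)%N, (j <= N)%N & f i = f j].
    apply: contrapT => nij.
    have finj : {in `I_N.+1 &, injective f}.
      move=> i j; rewrite !inE /= !ltnS => iN jN fij; apply: contrapT => /eqP.
      by rewrite neq_ltn => /orP[ij|ij]; apply: nij;
        [exists i, j|exists j, i].
    have : `I_N.+1 #<= `I_N by apply: (card_le_fun (f := f)) => [x _|x y xN yN];
      [exact: fN|by apply: finj; rewrite inE].
    by rewrite card_le_II ltnn.
  have z : s *+ (j - i) = 0.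
    apply: dS; first exact: SM.
    exists (r j - r i); last by rewrite tpiB -!(rP _).2 mulrnBr // ltnW.
    apply: lt_trans Nd; rewrite -[X in _ < X]mul1r ltr_pdivlMr //.
    rewrite -[X in _ * X](gtr0_norm N0) -normrM mulrBl ltr_norml.
    have := floor_itv (r i * N%:R); have := floor_itv (r j * N%:R).
    have fl k : (Num.floor (r k * N%:R))%:~R = (f k)%:R :> R.
      have [/andP[r0 r1] _] := rP k.
      by rewrite /f natr_absz ger0_norm // floor_ge0 mulr_ge0.
    rewrite !intrD !fl fij => /andP[? ?] /andP[? ?]; apply/andP; split; lra.
  have /dvdnP[k ->] : (j - i %| N`!)%N.
    by apply: dvdn_fact; rewrite subn_gt0 ij /= (leq_trans (leq_subr _ _)).
  by rewrite mulnC mulrnA z mul0rn.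
left; apply/seteqP; split=> // t _.
apply: torus_closedP => // e e0.
have [s [Ss [r re sr] s0]] : exists s, [/\ S s, small e s & s <> 0].
  apply: contrapT => ns; apply: nd; exists e => // s Ss se.
  by apply: contrapT => s0; apply: ns; exists s.
wlog r0 : s r Ss re sr s0 / 0 <= r.
  move=> H; have [r0|r0] := leP 0 r; first exact: H Ss re sr s0 r0.
  apply: (H (- s) (- r)); rewrite ?normrN ?tpiN ?sr ?oppr_ge0 ?(ltW r0) //.
    by rewrite -sr; apply: SN.
  by move=> /eqP; rewrite oppr_eq0 -sr => /eqP.
have {}r0 : 0 < r.
  by rewrite lt_def r0 andbT; apply: contra_notN s0 => /eqP r00; rewrite sr r00 tpi0.
have [x /andP[x0 _] ->] := tpi_surj t.
have k0 : 0 <= Num.floor (x / r) by rewrite floor_ge0 divr_ge0 // ltW.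
exists (s *+ `|Num.floor (x / r)|); first exact: SM.
exists (r *+ `|Num.floor (x / r)| - x); last by rewrite tpiB tpiMn -sr.
apply: le_lt_trans re; rewrite (gtr0_norm r0) -mulr_natl natr_absz (ger0_norm k0).
have /andP[] := floor_itv (x / r).
rewrite -(ler_pM2r r0) -(ltr_pM2r r0) divfK ?gt_eqF // intrD mulrDl mul1r.
by move=> *; rewrite ler_norml; apply/andP; split; lra.
Qed.

End torus.

(** * Closed subgroups of powers of the torus and Kronecker's theorem *)

Section powers.
Variables (R : realType) (I : choiceType).
Local Notation T := (torus R).
Local Notation P := (torus_power R I).
Implicit Types (f g m p : P) (F : seq I) (e d : R) (M : set P).

Lemma power_nbhsP f (A : set P) : nbhs f A <->
  exists F e, 0 < e /\ forall g, {in F, forall x, small e (g x - f x)} -> A g.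
Proof.
split; last first.
  move=> [F [e [e0 FA]]]; apply: filterS FA _.
  elim: F => [|x F IH]; first by apply: filterS filterT => g _ x.
  have xn : nbhs f [set g : P | small e (g x - f x)].
    have h := @proj_continuous I (fun=> T) x f.
    apply: (h [set s | small e (s - f x)]); apply/torus_nbhsP.
    by exists e.
  apply: filterS (filterI xn IH) => g [gx gF] y.
  by rewrite inE => /predU1P[->|] //; apply: gF.
pose G := [set A : set P | exists F e, 0 < e /\
  forall g, {in F, forall x, small e (g x - f x)} -> A g].
have GF : Filter G.
  split.
  - by exists [::], 1.
  - move=> A1 A2 [F1 [e1 [e10 h1]]] [F2 [e2 [e20 h2]]].
    exists (F1 ++ F2), (Num.min e1 e2); rewrite lt_min e10 e20; split=> // g gF.
    split; [apply: h1|apply: h2] => x xF;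
      (apply: smallW (gF x _); last by rewrite mem_cat xF ?orbT);
      by rewrite ge_min lexx ?orbT.
  - move=> A1 A2 A12 [F [e [e0 h]]]; exists F, e; split=> // g /h.
    exact: A12.
suff H : cvg_to G (nbhs f) by exact: H.
apply/(@cvg_sup _ _ (fun x => Topological.class
  (initial_topology (fun h : I -> T => h x)))) => x B [_ [[O oO <-] Ofx] OB].
have [e e0 eO] : exists2 e, 0 < e & forall s, small e s -> O (f x + s).
  by have /torus_openP := oO; apply.
exists [:: x], e; split=> // g gx; apply: OB => /=.
by rewrite -[g x](subrK (f x)) addrC; apply: eO; apply: gx; rewrite inE.
Qed.

Lemma power_compact : compact [set: P].
Proof.
have -> : [set: P] = [set f : P | forall i, [set: T] (f i)] by apply/seteqP.
exact: (@tychonoff I (fun=> T) (fun=> setT) (fun=> @torus_compact R)).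
Qed.

Lemma power_cluster (g : nat -> P) : exists f, forall F e N, 0 < e ->
  exists2 n, (N <= n)%N & {in F, forall x, small e (g n x - f x)}.
Proof.
have [f [_ fcl]] := @power_compact (fmap g \oo) (fmap_proper_filter g _) filterT.
exists f => F e N e0.
have /fcl : (g @ \oo) [set g n | n in [set n | (N <= n)%N]].
  by exists N => // n /= Nn; exists n.
case/(_ [set h : P | {in F, forall x, small e (h x - f x)}]).
  by apply/power_nbhsP; exists F, e.
by move=> _ [[n Nn <-] h]; exists n.
Qed.

(** Closedness in the product topology, tested on finitely many coordinates. *)
Definition power_closed M := forall f,
  (forall F e, 0 < e ->
    exists2 g, M g & {in F, forall x, small e (g x - f x)}) -> M f.

(** Subgroups as sets. *)
Definition subgroup M := M 0 /\ forall f g, M f -> M g -> M (f - g).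

(** Continuous characters of the power. *)
Definition cchar (u : P -> T) := {morph u : f g / f - g} /\
  forall e, 0 < e -> exists F d, 0 < d /\
    forall f, {in F, forall x, small d (f x)} -> small e (u f).

Lemma ccharB u v : cchar u -> cchar v -> cchar (fun f => u f - v f).
Proof.
move=> [uB uc] [vB vc]; split.
  move=> f g; rewrite uB vB !opprB addrACA [RHS]addrACA.
  by rewrite [- u g - _]addrC.
move=> e e0; have e2 : 0 < e / 2 by rewrite divr_gt0.
have [F [d [d0 h]]] := uc _ e2; have [F' [d' [d'0 h']]] := vc _ e2.
exists (F ++ F'), (Num.min d d'); rewrite lt_min d0; split=> // f fF.
rewrite [e]splitr; apply: smallD; last apply: smallN.
  apply: h => x xF; apply: smallW (fF x _); first by rewrite ge_min lexx.
  by rewrite mem_cat xF.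
apply: h' => x xF; apply: smallW (fF x _); first by rewrite ge_min lexx orbT.
by rewrite mem_cat xF orbT.
Qed.

Lemma cchar0 : cchar (fun=> 0).
Proof.
split=> [f g|e e0]; first by rewrite subr0.
by exists [::], 1; split=> // f _; apply: small0.
Qed.

Lemma ccharN u : cchar u -> cchar (fun f => - u f).
Proof.
by move=> /(ccharB cchar0); congr cchar; apply/funext => f; rewrite sub0r.
Qed.

Lemma ccharMz u n : cchar u -> cchar (fun f => u f *~ n).
Proof.
move=> cu.
have H (k : nat) : cchar (fun f => u f *+ k).
  elim: k => [|k IH].
    by have := cchar0; congr cchar; apply/funext => f; rewrite mulr0n.
  have := ccharB cu (ccharN IH); congr cchar; apply/funext => f.
  by rewrite opprK mulrS.
by case: n => k; [exact: H|exact: ccharN (H k.+1)].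
Qed.

Lemma cchar_coord x : cchar (fun f => f x).
Proof.
split=> // e e0; exists [:: x], e; split=> // f; apply.
by rewrite inE.
Qed.

Lemma cchar_comb F (a : I -> int) : cchar (fun f => \sum_(x <- F) f x *~ a x).
Proof.
elim: F => [|x F IH].
  by have := cchar0; congr cchar; apply/funext => f; rewrite big_nil.
have := ccharB (ccharMz (a x) (cchar_coord x)) (ccharN IH).
by congr cchar; apply/funext => f; rewrite opprK big_cons.
Qed.

Lemma cchar_0 u : cchar u -> u 0 = 0.
Proof. by move=> cu; rewrite -(subrr 0) cu.1 subrr. Qed.

Lemma cchar_mulrn u f k : cchar u -> u (f *+ k) = u f *+ k.
Proof.
move=> cu; have u0 := cchar_0 cu.
elim: k => [|k IH]; first by rewrite !mulr0n.
by rewrite !mulrS -{1}[f *+ k]opprK cu.1 -sub0r cu.1 u0 sub0r opprK IH.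
Qed.

Section characters.
Variables (M : set P) (u : P -> T).
Hypotheses (cM : power_closed M) (sM : subgroup M) (cu : cchar u).

Let u0 : u 0 = 0 := cchar_0 cu.

Lemma subgroup_mulrn f k : M f -> M (f *+ k).
Proof.
move=> Mf; elim: k => [|k IH]; first by rewrite mulr0n; apply: sM.1.
rewrite mulrS -[f *+ k]opprK; apply: sM.2 => //.
by rewrite -sub0r; apply: sM.2 => //; apply: sM.1.
Qed.

(** Sequential compactness: from approximate solutions of u = t in M, a limit
    which is an exact solution in M, and a cluster point of the sequence. *)
Lemma cchar_limit (g : nat -> P) t :
    (forall n, M (g n)) -> (forall n, small n.+1%:R^-1 (u (g n) - t)) ->
  exists f, [/\ M f, u f = t & forall F e N, 0 < e ->
    exists2 n, (N <= n)%N & {in F, forall x, small e (g n x - f x)}].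
Proof.
move=> Mg ug; have [f fcl] := power_cluster g; exists f; split=> //.
  by apply: cM => F e e0; have [n _ h] := fcl F e 0%N e0; exists (g n).
apply/eqP; rewrite -subr_eq0; apply/eqP; apply: small_eq0 => e e0.
have e2 : 0 < e / 2 by rewrite divr_gt0.
have [F [d [d0 h]]] := cu.2 _ e2.
have [n Nn /h] := fcl F d (Num.bound (e / 2)^-1) d0.
rewrite cu.1 => /smallN; rewrite opprB => h1.
rewrite -[u f](subrK (u (g n))) -addrA [e]splitr; apply: smallD => //.
apply: smallW (ug n); rewrite invf_ple ?posrE ?ltr0n //.
apply: ltW; apply: lt_trans (archi_boundP _) _; first by rewrite invr_ge0 ltW.
by rewrite ltr_nat ltnS.
Qed.

Lemma cchar_image_closed : closed (u @` M).
Proof.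
move=> t tcl.
have /choice[g gP] : forall n : nat, exists g, M g /\ small n.+1%:R^-1 (u g - t).
  move=> n; have [|_ [[g Mg <-] ?]] := tcl [set s | small n.+1%:R^-1 (s - t)].
    by apply/torus_nbhsP; exists n.+1%:R^-1 => //; rewrite invr_gt0 ltr0n.
  by exists g.
have [||f [Mf <- _]] := cchar_limit (g := g) (t := t); last by exists f.
  by move=> n; case: (gP n).
by move=> n; case: (gP n).
Qed.

Lemma cchar_image_subgroup s t : (u @` M) s -> (u @` M) t -> (u @` M) (s - t).
Proof.
move=> [f Mf <-] [g Mg <-]; exists (f - g); first exact: sM.2.
exact: cu.1.
Qed.

(** A character of a compact group that vanishes on the kernel of another one
    is a multiple of it. *)
Lemma cchar_multiple v : cchar v -> (forall m, M m -> u m = 0 -> v m = 0) ->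
  exists a : int, forall m, M m -> v m = u m *~ a.
Proof.
move=> cv uv.
have M0 : M 0 by exact: sM.1.
have S0 : (u @` M) 0 by exists 0.
have [ST|[q q0 qS]] :=
    torus_closed_subgroup cchar_image_closed S0 cchar_image_subgroup; last first.
  (* u takes finitely many values k/q; the least positive one generates *)
  have qM m : M m -> exists2 k : nat, (k < q)%N & u m = tpi (k%:R / q%:R).
    move=> Mm; have [r /andP[r0 r1] ur] := tpi_surj (u m).
    have q0' : 0 < q%:R :> R by rewrite ltr0n.
    have /tpi_eq0P[n nE] : tpi (r *+ q) = 0.
      by rewrite tpiMn -ur; apply: qS; exists m.
    have n0 : 0 <= n by rewrite -(ler0z R) -nE mulrn_wge0.
    have nE' : r = `|n|%:R / q%:R.
      apply: (mulIf (lt0r_neq0 q0')); rewrite divfK ?lt0r_neq0 //.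
      by rewrite mulr_natr nE natr_absz ger0_norm.
    exists `|n|%N; last by rewrite ur nE'.
    by move: r1; rewrite nE' ltr_pdivrMr // mul1r ltr_nat.
  pose Pk k := `[< (0 < k)%N /\ exists2 m, M m & u m = tpi (k%:R / q%:R) >].
  have [k0 /asboolP[k0gt [m0 Mm0 um0]] k0min] :
      exists2 k, Pk k & forall j, Pk j -> (k <= j)%N.
    have exP : exists k, Pk k.
      exists q; apply/asboolP; split=> //; exists 0 => //.
      rewrite divff ?pnatr_eq0 -?lt0n // u0; apply/esym/tpi_eq0P.
      by exists 1.
    by case: (ex_minnP exP) => k Pkk kmin; exists k.
  have q0' : q%:R != 0 :> R by rewrite pnatr_eq0 -lt0n.
  have k0' : k0%:R != 0 :> R by rewrite pnatr_eq0 -lt0n.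
  have dvd k m : M m -> u m = tpi (k%:R / q%:R) -> (k0 %| k)%N.
    move=> Mm um; rewrite /dvdn eqn0Ngt; apply/negP => r0.
    suff /k0min : Pk (k %% k0)%N by rewrite leqNgt ltn_pmod.
    apply/asboolP; split=> //; exists (m - m0 *+ (k %/ k0)).
      by apply: sM.2 => //; apply: subgroup_mulrn.
    rewrite cu.1 (cchar_mulrn _ _ cu) um um0 -tpiMn -tpiB; congr tpi.
    rewrite -mulrnAl -mulrBl -mulrnA {1}(divn_eq k k0) natrD.
    by rewrite mulnC addrC addKr.
  have [n nq] : exists n, q = (n * k0)%N.
    apply/dvdnP; apply: (dvd q 0) => //.
    by rewrite divff // u0; apply/esym/tpi_eq0P; exists 1.
  have n0' : n%:R != 0 :> R.
    by move: q0; rewrite nq muln_gt0 => /andP[n0 _]; rewrite pnatr_eq0 -lt0n.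
  have um0' : u m0 = tpi n%:R^-1.
    by rewrite um0 nq natrM invfM mulrCA mulfV // mulr1.
  have [r _ vr] := tpi_surj (v m0).
  have /tpi_eq0P[a aE] : tpi (r *+ n) = 0.
    rewrite tpiMn -vr -(cchar_mulrn _ _ cv); apply: uv; first exact: subgroup_mulrn.
    rewrite (cchar_mulrn _ _ cu) um0' -tpiMn -[_^-1 *+ _]mulr_natr mulVf //; apply/tpi_eq0P.
    by exists 1.
  have va : v m0 = u m0 *~ a.
    rewrite vr um0' -tpiMz; congr tpi; rewrite -mulrzl -aE -[r *+ _]mulr_natr.
    by rewrite mulfK.
  exists a => m Mm; have [k kq um] := qM m Mm.
  have /dvdnP[c kc] := dvd k m Mm um.
  have umc : u m = u m0 *+ c.
    by rewrite um um0 -tpiMn kc natrM -mulrA mulr_natl.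
  have : v (m - m0 *+ c) = 0.
    apply: uv; first by apply: sM.2 => //; apply: subgroup_mulrn.
    by rewrite cu.1 (cchar_mulrn _ _ cu) umc subrr.
  rewrite cv.1 (cchar_mulrn _ _ cv) va => /eqP; rewrite subr_eq0 => /eqP ->.
  by rewrite umc !pmulrn -!mulrzA mulrC.
have uM t : exists2 m, M m & u m = t.
  by have : (u @` M) t by rewrite ST.
(* by compactness, v is small where u is *)
have [N h] : exists N, forall m, M m -> small N.+1%:R^-1 (u m) -> small 6%:R^-1 (v m).
  apply: contrapT => nN.
  have /choice[g gP] : forall n : nat, exists g,
      [/\ M g, small n.+1%:R^-1 (u g) & ~ small 6%:R^-1 (v g)].
    move=> n; apply: contrapT => ng; apply: nN; exists n => m Mm um.
    by apply: contrapT => vm; apply: ng; exists m.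
  have [||f [Mf uf fcl]] := cchar_limit (g := g) (t := 0).
  - by move=> n; case: (gP n).
  - by move=> n; rewrite subr0; case: (gP n).
  have [|F [d [d0 vF]]] := cv.2 6%:R^-1; first by rewrite invr_gt0 ltr0n.
  have [n _ /vF] := fcl F d 0%N d0.
  by rewrite cv.1 (uv f) // subr0; case: (gP n).
pose n := N.+2; have n0 : 0 < n%:R :> R by rewrite ltr0n.
have nN : n%:R^-1 < N.+1%:R^-1 :> R by rewrite ltf_pV2 ?posrE ?ltr0n // ltr_nat.
have [m0 Mm0 um0] := uM (tpi n%:R^-1).
have [r r6 vr] : small 6%:R^-1 (v m0).
  by apply: h => //; exists n%:R^-1 => //; rewrite gtr0_norm ?invr_gt0.
have /tpi_eq0P[a aE] : tpi (r *+ n) = 0.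
  rewrite tpiMn -vr -(cchar_mulrn _ _ cv); apply: uv; first exact: subgroup_mulrn.
  rewrite (cchar_mulrn _ _ cu) um0 -tpiMn -[_^-1 *+ _]mulr_natr mulVf ?gt_eqF //; apply/tpi_eq0P.
  by exists 1.
have rE : r = a%:~R / n%:R by rewrite -aE -[r *+ _]mulr_natr mulfK // gt_eqF.
exists a; pose w f := v f - u f *~ a.
have cw : cchar w by apply: ccharB => //; apply: ccharMz.
have w0 : w m0 = 0 by rewrite /w vr um0 -tpiMz -mulrzl -rE subrr.
have wM m : M m -> small 3%:R^-1 (w m).
  move=> Mm; have [x /andP[x0 x1] ux] := tpi_surj (u m).
  pose k := `|Num.floor (x * n%:R)|%N.
  have kE : k%:R = (Num.floor (x * n%:R))%:~R :> R.
    by rewrite /k natr_absz ger0_norm // floor_ge0 mulr_ge0 // ltW.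
  have /andP[] := floor_itv (x * n%:R); rewrite intrD -kE => k1 k2.
  pose y := x - k%:R / n%:R.
  have y0 : 0 <= y by rewrite subr_ge0 ler_pdivrMr.
  have yn : y < n%:R^-1.
    by rewrite -(ltr_pM2r n0) mulVf ?gt_eqF // mulrBl divfK ?gt_eqF //; lra.
  have Mm' : M (m - m0 *+ k) by apply: sM.2 => //; apply: subgroup_mulrn.
  have um' : u (m - m0 *+ k) = tpi y.
    by rewrite cu.1 (cchar_mulrn _ _ cu) ux um0 -tpiMn -tpiB -[_ *+ k]mulr_natl.
  have <- : w (m - m0 *+ k) = w m.
    by rewrite cw.1 (cchar_mulrn _ _ cw) w0 mul0rn subr0.
  have -> : 3%:R^-1 = 6%:R^-1 + 6%:R^-1 :> R by lra.
  rewrite /w; apply: smallD.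
    by apply: h => //; exists y => //; rewrite ger0_norm //; apply: lt_trans yn nN.
  apply: smallN; rewrite um' -tpiMz; exists (y *~ a) => //.
  apply: le_lt_trans r6; rewrite rE -mulrzl !normrM ler_wpM2l //.
  by rewrite ger0_norm // gtr0_norm ?invr_gt0 // ltW.
move=> m Mm; apply/eqP; rewrite -subr_eq0; apply/eqP.
apply: (@no_small_multiples _ (w m)) => k.
by rewrite -(cchar_mulrn _ _ cw); apply: wM; apply: subgroup_mulrn.
Qed.

End characters.
End powers.

Section kronecker.
Variables (R : realType) (I : choiceType).
Local Notation T := (torus R).
Local Notation P := (torus_power R I).
Implicit Types (f g m p : P) (F : seq I) (e d : R) (M : set P).

Lemma power_closedI_ker M (u : P -> T) :
  power_closed M -> cchar u -> power_closed (M `&` [set m | u m = 0]).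
Proof.
move=> cM cu f fM; split.
  by apply: cM => F e e0; have [g [Mg _] gF] := fM F e e0; exists g.
apply: small_eq0 => e e0; have [F [d [d0 h]]] := cu.2 _ e0.
have [g [_ ug0] /h] := fM F d d0.
by rewrite cu.1 ug0 sub0r => /smallN; rewrite opprK.
Qed.

Lemma subgroupI_ker M (u : P -> T) :
  subgroup M -> cchar u -> subgroup (M `&` [set m | u m = 0]).
Proof.
move=> sM cu; split; first by split; [exact: sM.1|exact: cchar_0].
by move=> f g [Mf uf] [Mg ug]; split; [exact: sM.2|rewrite /= cu.1 uf ug subrr].
Qed.

(** Characters of a closed subgroup that vanish where finitely many coordinates
    vanish are integral combinations of these coordinates. *)
Lemma cchar_combination M (v : P -> T) F :
    power_closed M -> subgroup M -> cchar v -> uniq F ->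
    (forall m, M m -> {in F, forall x, m x = 0} -> v m = 0) ->
  exists a : I -> int, forall m, M m -> v m = \sum_(x <- F) m x *~ a x.
Proof.
elim: F M v => [|x F IH] M v cM sM cv.
  move=> _ vM; exists (fun=> 0) => m Mm.
  by rewrite big_nil; apply: vM.
move=> /= /andP[xF uF] vM.
pose M' := M `&` [set m | m x = 0].
have cx := @cchar_coord R I x.
have [|a aM'] := IH M' v (power_closedI_ker cM cx) (subgroupI_ker sM cx) cv uF.
  move=> m [Mm mx] mF; apply: vM => // y.
  by rewrite inE => /predU1P[->|/mF].
pose w f := v f - \sum_(y <- F) f y *~ a y.
have cw : cchar w by apply: ccharB => //; apply: cchar_comb.
have [|b bM] := cchar_multiple cM sM cx cw.
  by move=> m Mm mx; rewrite /w aM' ?subrr.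
exists (fun y => if y == x then b else a y) => m Mm.
rewrite big_cons eqxx -bM // /w -[LHS](subrK (\sum_(y <- F) m y *~ a y)).
congr (_ + _); apply: eq_big_seq => y yF.
by case: eqVneq => // yx; move: xF; rewrite -yx yF.
Qed.

(** All integral relations between the coordinates of g are supported in D. *)
Definition relations_within g (D : set I) := forall F (a : I -> int), uniq F ->
  \sum_(x <- F) g x *~ a x = 0 -> {in F, forall x, a x != 0 -> D x}.

(** Kronecker: the closure of the multiples of g contains all points that vanish
    on D. *)
Theorem kronecker g (D : set I) p F e : relations_within g D ->
    (forall x, D x -> p x = 0) -> 0 < e ->
  exists n : int, {in F, forall x, small e (g x *~ n - p x)}.
Proof.
move=> gD pD e0.
pose M : set P := [set f | forall F e, 0 < e ->
  exists n : int, {in F, forall x, small e (g x *~ n - f x)}].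
have cM : power_closed M.
  move=> f fM F' e' e'0; have e'2 : 0 < e' / 2 by rewrite divr_gt0.
  have [h /(_ F' _ e'2)[n nh] hf] := fM F' _ e'2.
  exists n => x xF; rewrite -[_ *~ n](subrK (h x)) -addrA [e']splitr.
  by apply: smallD; [apply: nh|apply: hf].
have sM : subgroup M.
  split.
    by move=> F' e' e'0; exists 0 => x _; rewrite mulr0z subr0; apply: small0.
  move=> f h fM hM F' e' e'0; have e'2 : 0 < e' / 2 by rewrite divr_gt0.
  have [n nf] := fM F' _ e'2; have [k kh] := hM F' _ e'2.
  exists (n - k) => x xF; rewrite mulrzBr.
  have -> : g x *~ n - g x *~ k - (f - h) x = (g x *~ n - f x) - (g x *~ k - h x).
    by rewrite -[(f - h) x]/(f x - h x) !opprB addrACA [RHS]addrACA [- _ - f x]addrC.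
  by rewrite [e']splitr; apply: smallD; [apply: nf|apply: smallN; apply: kh].
have Mg : M g by move=> F' e' e'0; exists 1 => x _; rewrite mulr1z subrr; apply: small0.
(* at a coordinate y outside of D, a point of M that vanishes at finitely many
   other coordinates is arbitrary: otherwise a multiple of the character y
   would be a combination of them, which is a relation of g involving y *)
have Mcoord F' y t : uniq F' -> y \notin F' -> ~ D y ->
    exists2 m, M m & m y = t /\ {in F', forall x, m x = 0}.
  move=> uF' yF' nDy.
  have [cMF sMF] : power_closed (M `&` [set m | {in F', forall x, m x = 0}]) /\
      subgroup (M `&` [set m | {in F', forall x, m x = 0}]).
    elim: F' {uF' yF'} => [|x F' [IHc IHs]].
      have -> // : M `&` [set m | {in [::], forall x, m x = 0}] = M.
      by apply/seteqP; split=> m; [case|].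
    have -> : M `&` [set m | {in x :: F', forall x, m x = 0}] =
        (M `&` [set m | {in F', forall x, m x = 0}]) `&` [set m | m x = 0].
      apply/seteqP; split=> [m [Mm h]|m [[Mm h] hx]].
        by split; [split=> // z zF|]; apply: h; rewrite inE ?zF ?orbT ?eqxx.
      by split=> // z; rewrite inE => /predU1P[->|/h].
    split; [apply: power_closedI_ker|apply: subgroupI_ker] => //;
      exact: cchar_coord.
  have cy := @cchar_coord R I y.
  have [|ST|[q q0 qS]] := torus_closed_subgroup
      (cchar_image_closed cMF cy) _ (cchar_image_subgroup sMF cy).
  - by exists 0 => //; exact: sMF.1.
  - have [m [Mm h] my] : ((fun m => m y) @` (M `&`
      [set m | {in F', forall x, m x = 0}])) t by rewrite ST.
    by exists m.
  have [|a aM] := @cchar_combination M (fun m => m y *~ q) F' cM sM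
      (ccharMz q cy) uF'.
    by move=> m Mm mF; rewrite -pmulrn; apply: qS; exists m.
  pose b x := if x == y then q%:Z else - a x.
  have : D y.
    apply: (gD (y :: F') b); [by rewrite /= yF'| |by rewrite inE eqxx|].
      rewrite big_cons /b eqxx (aM g Mg) -big_split /= big1_seq // => x /= xF.
      case: eqVneq => [xy|_]; first by move: yF'; rewrite -xy xF.
      by rewrite mulrNz subrr.
    by rewrite /b eqxx; case: q q0 {qS aM b}.
  by [].
wlog uF : F / uniq F.
  move=> H; have [n nF] := H (undup F) (undup_uniq F).
  by exists n => x xF; apply: nF; rewrite mem_undup.
have [m Mm mF] : exists2 m, M m & {in F, forall x, m x = p x}.
  suff H L : uniq L -> {subset L <= F} -> exists2 m, M m &
      {in F, forall x, m x = if x \in L then p x else 0}.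
    have [m Mm mF] := H F uF (fun x xF => xF).
    by exists m => // x xF; rewrite mF ?xF.
  elim: L => [|y L IH] /=; first by exists 0 => //; exact: sM.1.
  move=> /andP[yL uL] LF.
  have [|m Mm mF] := IH uL; first by move=> x xL; apply: LF; rewrite inE xL orbT.
  have yF : y \in F by apply: LF; rewrite inE eqxx.
  have [Dy|nDy] := pselect (D y).
    exists m => // x xF; rewrite mF // inE; case: eqVneq => [->|//].
    by rewrite (negPf yL) pD.
  have [||m' Mm' [m'y m'F]] := Mcoord (rem y F) y (- p y) _ _ nDy.
  - exact: rem_uniq.
  - by rewrite mem_rem_uniqF.
  exists (m - m'); first exact: sM.2.
  move=> x xF; rewrite -[(m - m') x]/(m x - m' x) mF // inE.
  case: eqVneq => [->|xy]; first by rewrite (negPf yL) m'y sub0r opprK.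
  by rewrite m'F ?subr0 // mem_rem_uniq // inE xy.
have [n nF] := Mm F e e0.
by exists n => x xF; rewrite -mF //; apply: nF.
Qed.

End kronecker.

(** * A continuum of independent elements of the torus *)

Section independent.
Variable R : realType.
Implicit Types (u : pred nat) (n m : nat).

(** Partial sums of the series of the 1/m! over the m in u. *)
Definition fact_sum u n : R := \sum_(i < n | u i) (i`!%:R)^-1.

Lemma fact_sumS u n :
  fact_sum u n.+1 = fact_sum u n + (if u n then (n`!%:R)^-1 else 0).
Proof. by rewrite /fact_sum big_mkcond big_ord_recr /= -big_mkcond. Qed.

Lemma fact_inv_ge0 n : 0 <= (n`!%:R)^-1 :> R.
Proof. by rewrite invr_ge0. Qed.

Lemma fact_invS n : (n.+1`!%:R)^-1 = n.+1%:R^-1 * (n`!%:R)^-1 :> R.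
Proof. by rewrite factS natrM invfM. Qed.

Lemma fact_sum_tail u n m : (0 < n)%N ->
  fact_sum u m <= fact_sum u n + 2 * (n`!%:R)^-1.
Proof.
move=> n0.
have mono i j : (i <= j)%N -> fact_sum u i <= fact_sum u j.
  move=> /subnK <-; elim: (j - i)%N => [//|k IH].
  rewrite addSn fact_sumS; apply: le_trans IH _; rewrite lerDl.
  by case: ifP => // _; apply: fact_inv_ge0.
have f0 := fact_inv_ge0.
have [mn|/ltnW nm] := leqP m n.
  by apply: le_trans (mono _ _ mn) _; rewrite lerDl mulr_ge0.
have H k : fact_sum u (k + n) + 2 * ((k + n)`!%:R)^-1 <=
           fact_sum u n + 2 * (n`!%:R)^-1.
  elim: k => [//|k IH]; apply: le_trans IH; rewrite addSn.
  set j := (k + n)%N; have j0 : (0 < j)%N by rewrite addn_gt0 n0 orbT.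
  rewrite fact_sumS -addrA lerD2l fact_invS.
  have h : 2 * (j.+1%:R^-1 * (j`!%:R)^-1) <= (j`!%:R)^-1 :> R.
    rewrite mulrA ler_piMl // ler_pdivrMr ?ltr0n // mul1r.
    by rewrite ler_nat ltnS.
  move: (f0 j) h; set c := (j`!%:R)^-1; set c' := 2 * (_ * c) => c0 h.
  by case: ifP => _; lra.
have := H (m - n)%N; rewrite subnK //; apply: le_trans.
by rewrite lerDl mulr_ge0.
Qed.

(** The real number with the given factorial expansion. *)
Lemma fact_series u : exists r : R, forall n, (0 < n)%N ->
  fact_sum u n <= r <= fact_sum u n + 2 * (n`!%:R)^-1.
Proof.
exists (sup (range (fact_sum u))) => n n0; apply/andP; split.
  apply: ub_le_sup; last by exists n.
  exists (fact_sum u 1 + 2 * (1`!%:R)^-1) => _ [m _ <-].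
  exact: fact_sum_tail.
apply: ge_sup; first by exists (fact_sum u 0), 0%N.
by move=> _ [m _ <-]; apply: fact_sum_tail.
Qed.

Lemma fact_sum_int u m : exists N : nat, fact_sum u m.+1 * m`!%:R = N%:R.
Proof.
exists (\sum_(i < m.+1 | u i) m`! %/ i`!)%N.
rewrite natr_sum mulr_suml; apply: eq_bigr => i _.
have /dvdnP[q qE] : (i`! %| m`!)%N.
  by rewrite -(@bin_fact m i) -1?ltnS // mulnC -mulnA dvdn_mulr.
by rewrite qE mulnK ?fact_gt0 // natrM mulrCA mulVf ?mulr1 // pnatr_eq0 -lt0n fact_gt0.
Qed.

(** The branch of the binary tree defined by a point of the Cantor space, as a
    set of codes of its nodes; distinct branches are almost disjoint. *)
Definition branch (x : nat -> bool) : pred nat :=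
  fun m => `[< exists n, pickle (mkseq x n) = m >].

Lemma branch_unbounded x B : exists2 m, (B < m)%N & branch x m.
Proof.
have inj : injective (fun n => pickle (mkseq x n)).
  move=> i j /(pcan_inj pickleK)/(congr1 size).
  by rewrite !size_mkseq.
have [n Bn] := injective_gtn inj B.
by exists (pickle (mkseq x n)) => //; apply/asboolP; exists n.
Qed.

Lemma branch_disjoint x y : x <> y ->
  exists B, forall m, (B < m)%N -> branch x m -> ~~ branch y m.
Proof.
move=> xy; have [i xyi] : exists i, x i <> y i.
  by apply/existsNP => h; apply: xy; apply/funext.
exists (\sum_(n < i.+1) pickle (mkseq x n))%N => m Bm /asboolP[n nm].
apply/asboolP => -[n' n'm].
have E : mkseq x n = mkseq y n' by apply: (pcan_inj pickleK); rewrite nm n'm.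
have nn' : n = n' by have := congr1 size E; rewrite !size_mkseq.
have ni : (n < i.+1)%N.
  rewrite ltnS leqNgt; apply/negP => ni; apply: xyi.
  by have := congr1 (fun s => nth false s i) E; rewrite -nn' !nth_mkseq.
move: Bm; rewrite -nm (bigD1 (Ordinal ni)) //= ltnNge => /negP; apply.
exact: leq_addr.
Qed.

(** The Cantor space indexes a family of integrally independent elements of
    the torus. *)
Theorem independent_family :
  exists t : torus_power R (nat -> bool), relations_within t set0.
Proof.
have /choice[r rP] := fun x : nat -> bool => fact_series (branch x).
exists (fun x => tpi (r x)) => F a uF Fa y yF; apply: contra_neqP => _.
have {Fa} /tpi_eq0P[k kE] : tpi (\sum_(x <- F) r x *~ a x) = 0.
  rewrite -Fa; elim: F {uF yF Fa} => [|x F IH]; first by rewrite !big_nil tpi0.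
  by rewrite !big_cons tpiD tpiMz IH.
pose A := \sum_(x <- F) `|a x|%N.
have aA x : x \in F -> (`|a x| <= A)%N.
  by move=> xF; rewrite /A (big_rem x) //= leq_addr.
have [B BP] : exists B, forall x m, x \in F -> x <> y -> (B < m)%N ->
    branch y m -> ~~ branch x m.
  elim: F {uF yF kE A aA} => [|x F [B IH]]; first by exists 0%N.
  have [->|/eqP xy] := eqVneq x y.
    by exists B => z m; rewrite inE => /predU1P[->//|]; apply: IH.
  have [B' h] := branch_disjoint (nesym xy).
  exists (B + B')%N => z m; rewrite inE => /predU1P[->|zF] zy Bm ym.
    by apply: h => //; apply: leq_ltn_trans Bm; apply: leq_addl.
  by apply: (IH z m zF zy) => //; apply: leq_ltn_trans Bm; apply: leq_addr.
have [M BM yM] := branch_unbounded y (B + A.*2).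
case: M BM yM => // m BM yM.
have Am : (A.*2 < m.+1)%N by apply: leq_ltn_trans BM; apply: leq_addl.
have /choice[N NE] := fun x => fact_sum_int (branch x) m.
have /choice[d dE] : forall x, exists d, [/\ 0 <= d <= 2 * (m.+2`!%:R)^-1 &
    r x = fact_sum (branch x) m.+2 + d].
  move=> x; exists (r x - fact_sum (branch x) m.+2); split; last by rewrite addrC subrK.
  by have /andP[h1 h2] := rP x m.+2 isT; apply/andP; split; lra.
have f0 n : (n`!%:R) != 0 :> R by rewrite pnatr_eq0 -lt0n fact_gt0.
(* k m! is an integer, and so is the part of the sum up to m!; what is left,
   multiplied by m + 1, is the coefficient of y up to an error less than one *)
pose z : int := k * m`!%:Z - \sum_(x <- F) (N x)%:Z * a x.
have zE : z%:~R * m.+1%:R = (a y)%:~R + m.+1`!%:R * \sum_(x <- F) d x *~ a x :> R.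
  have zN : z%:~R = m`!%:R * \sum_(x <- F) (r x - fact_sum (branch x) m.+1) *~ a x :> R.
    have -> : z%:~R = m`!%:R * k%:~R - \sum_(x <- F) (N x)%:R * (a x)%:~R :> R.
      rewrite /z intrB intrM mulrC (rmorph_sum (intmul (1 : R))); congr (_ - _).
      by apply: eq_bigr => x _; rewrite /= intrM.
    rewrite -kE !mulr_sumr -sumrB; apply: eq_bigr => x _.
    rewrite mulrzBl mulrBr; congr (_ - _).
    by rewrite -NE mulrzr mulrzAr [_ * m`!%:R]mulrC.
  rewrite zN (eq_big_seq (fun x => (if x == y then (m.+1`!%:R)^-1 else 0) *~ a x
      + d x *~ a x)); last first.
    move=> x xF; rewrite -mulrzDl; congr (_ *~ _).
    have [_ ->] := dE x; rewrite (fact_sumS _ m.+1) addrAC [X in X + _]addrAC subrr add0r.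
    congr (_ + _); case: eqVneq => [->|/eqP xy]; first by rewrite yM.
    rewrite (negPf (BP x m.+1 xF xy _ yM)) //.
    by apply: leq_ltn_trans BM; apply: leq_addr.
  rewrite big_split /= (bigD1_seq y) //= eqxx big1 ?addr0; last first.
    by move=> x xy; rewrite (negPf xy) mul0rz.
  have -> : m.+1`!%:R = m`!%:R * m.+1%:R :> R by rewrite factS mulnC natrM.
  rewrite mulrAC mulrDr; congr (_ + _).
  by rewrite -mulrzr mulrA mulfV ?mul1r // mulf_neq0 // pnatr_eq0.
set rho := (X in _ + X) in zE.
have rho1 : `|rho| < 1.
  have dA : `|\sum_(x <- F) d x *~ a x| <= A%:R * (2 * (m.+2`!%:R)^-1).
    apply: le_trans (ler_norm_sum _ _ _) _.
    rewrite /A natr_sum mulr_suml; apply: ler_sum => x _.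
    have [/andP[d0 d1] _] := dE x.
    rewrite -mulrzr normrM mulrC (ger0_norm d0) natr_absz intr_norm.
    by apply: ler_wpM2l.
  rewrite /rho normrM normr_nat.
  have f1 : 0 < m.+1`!%:R :> R by rewrite ltr0n fact_gt0.
  apply: le_lt_trans (ler_wpM2l (ltW f1) dA) _.
  have -> : m.+1`!%:R * (A%:R * (2 * (m.+2`!%:R)^-1)) = A.*2%:R / m.+2%:R :> R.
    rewrite fact_invS -muln2 natrM.
    by rewrite [LHS]mulrC -!mulrA mulVf ?gt_eqF // mulr1.
  by rewrite ltr_pdivrMr ?ltr0n // mul1r ltr_nat ltnW.
have rho0 : z * m.+1%:Z = a y.
  have E : rho = (z * m.+1%:Z - a y)%:~R.
    by rewrite intrB intrM zE addrAC subrr add0r.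
  apply/eqP; rewrite -subr_eq0; move: rho1; rewrite E -intr_norm.
  by rewrite -[1]/(1%:~R) ltr_int; case: (_ - _) => [[|?]|?].
have : (m.+1 %| `|a y|)%N by rewrite -rho0 abszM dvdn_mull.
have [//|ay0] := eqVneq (a y) 0.
move=> /dvdn_leq; rewrite absz_gt0 ay0 => /(_ isT).
rewrite leqNgt => /negP[]; apply: leq_ltn_trans (aA y yF) _.
by apply: leq_ltn_trans Am; rewrite -addnn leq_addr.
Qed.

End independent.

(** * The group generated by a family of partially independent points *)

Lemma big_seq_extend (I : eqType) (V : zmodType) (h : I -> V) (a : I -> int)
    (F G : seq I) : uniq F -> uniq G -> {subset F <= G} ->
  \sum_(x <- F) h x *~ a x = \sum_(x <- G) h x *~ (if x \in F then a x else 0).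
Proof.
move=> uF uG FG; rewrite [RHS](bigID [in F]) /= [X in _ + X]big1 ?addr0; last first.
  by move=> x /negPf ->; rewrite mulr0z.
rewrite -[RHS]big_filter; have E : perm_eq F [seq x <- G | x \in F].
  apply: uniq_perm => //; first exact: filter_uniq.
  move=> x; rewrite mem_filter; case xF : (x \in F) => //=.
  by rewrite FG.
rewrite (perm_big _ E) /= big_filter [RHS]big_filter; apply: eq_bigr => x xF.
by rewrite xF.
Qed.

Lemma countableU T (A B : set T) :
  countable A -> countable B -> countable (A `|` B).
Proof.
move=> cA cB.
have -> : A `|` B = \bigcup_(b in [set: bool]) (if b then A else B).
  apply/seteqP; split=> [x [Ax|Bx]|x [[] _ ?]]; [by exists true|by exists false|by left|by right].
by apply: bigcup_countable => // -[].
Qed.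

Lemma ex_zmodClosed (V : zmodType) (S : set V) :
  S 0 -> (forall x y, S x -> S y -> S (x - y)) ->
  exists N : zmodClosed V, [set` N] = S.
Proof.
move=> S0 SB.
pose p : {pred V} := fun x => `[< S x >].
have pz : zmod_closed p.
  split=> [|x y]; rewrite !unfold_in; first exact/asboolP.
  by move=> /asboolP Sx /asboolP Sy; apply/asboolP; apply: SB.
pose N : zmodClosed V := HB.pack p (GRing.isZmodClosed.Build V p pz).
exists N; apply/seteqP; split=> x; first by move=> /asboolP.
by move=> Sx; apply/asboolP.
Qed.

Section generators.
Variables (R : realType) (I : choiceType).
Local Notation T := (torus R).
Local Notation P := (torus_power R I).
Variable t : I -> I -> T.
Hypothesis t_indep : forall (F : seq (I * I)) a, uniq F ->
  \sum_(p <- F) t p.1 p.2 *~ a p = 0 -> {in F, forall p, a p = 0}.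
Variables (D : I -> set I) (phi : I -> P).

(** The generator of index c has prescribed coordinates on [D c], and
    independent ones elsewhere. *)
Definition gen (c : I) : P := fun x => if `[< D c x >] then phi c x else t c x.

(** The combination of the generators indexed by L with coefficients n; the values
    of n outside of L are irrelevant. *)
Definition comb (L : seq I) (n : I -> int) : P := \sum_(c <- L) gen c *~ n c.

Lemma power_mulrz (f : P) (n : int) x : (f *~ n) x = f x *~ n.
Proof.
have H k : (f *+ k) x = f x *+ k.
  elim: k => [|k IH]; first by rewrite !mulr0n.
  by rewrite !mulrS -IH.
by case: n => k; rewrite ?NegzE ?mulrNz -!pmulrn -?H.
Qed.

Lemma power_sum (J : Type) (L : seq J) (f : J -> P) x :
  (\sum_(c <- L) f c) x = \sum_(c <- L) f c x.
Proof. by elim: L => [|c L IH]; rewrite ?big_nil ?big_cons // -IH. Qed.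

Lemma combE L n x : comb L n x = \sum_(c <- L) gen c x *~ n c.
Proof. by rewrite /comb power_sum; apply: eq_bigr => c _; rewrite power_mulrz. Qed.

(** The group generated by all generators. *)
Definition span : set P := [set g | exists L n, uniq L /\ g = comb L n].

Lemma span0 : span 0.
Proof. by exists [::], (fun=> 0); rewrite /comb big_nil. Qed.

Lemma spanB f g : span f -> span g -> span (f - g).
Proof.
move=> [L [n [uL ->]]] [L' [n' [uL' ->]]].
pose G := undup (L ++ L'); have uG : uniq G by apply: undup_uniq.
exists G, (fun c => (if c \in L then n c else 0) - (if c \in L' then n' c else 0)).
split=> //; rewrite /comb.
rewrite (big_seq_extend _ _ uL uG); last by move=> c; rewrite mem_undup mem_cat => ->.
rewrite (big_seq_extend _ _ uL' uG); last by move=> c; rewrite mem_undup mem_cat => ->; rewrite orbT.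
by rewrite -sumrB; apply: eq_bigr => c _; rewrite mulrzBr.
Qed.

Lemma span_gen c : span (gen c).
Proof. by exists [:: c], (fun=> 1); rewrite /comb big_seq1. Qed.

Lemma t_indep2 (L F : seq I) (b : I -> I -> int) : uniq L -> uniq F ->
  \sum_(x <- F) \sum_(c <- L) t c x *~ b c x = 0 ->
  forall c x, c \in L -> x \in F -> b c x = 0.
Proof.
move=> uL uF h c x cL xF.
have := @t_indep [seq (c, x) | c <- L, x <- F] (fun p => b p.1 p.2) _ _ (c, x) _.
apply.
- by apply: allpairs_uniq => // -[? ?] [? ?].
- by rewrite exchange_big /= in h; rewrite big_allpairs.
- by apply/allpairsP; exists (c, x).
Qed.

Variable PP : set (set I).
Hypothesis D_type : forall c,
  countable (D c) \/ PP (D c) /\ forall x, D c x -> phi c x = 0.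
Hypothesis PP_disjoint : forall A B x, PP A -> PP B -> A x -> B x -> A = B.

Section combination.
Variables (L : seq I) (n : I -> int) (c0 : I).
Hypotheses (uL : uniq L) (c0L : c0 \in L) (nc0 : n c0 != 0).

(** Only generators attached to pieces: the combination is a nontrivial
    combination of independent elements at every coordinate outside of the
    intersection of the pieces. *)
Lemma relations_pieces :
    (forall c, c \in L -> n c != 0 -> PP (D c) /\ forall x, D c x -> phi c x = 0) ->
  relations_within (comb L n) [set x | forall c, c \in L -> n c != 0 -> D c x].
Proof.
move=> LP F a uF Fa x xF ax c cL nc; apply: contrapT => nDcx.
have E y : comb L n y =
    \sum_(c <- L) t c y *~ (if `[< D c y >] then 0 else n c).
  rewrite combE; apply: eq_big_seq => d dL.
  have [->|nd] := eqVneq (n d) 0; first by rewrite mulr0z if_same mulr0z.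
  rewrite /gen; case: asboolP => // Ddy.
  by rewrite (LP d dL nd).2 // mul0rz mulr0z.
pose b c y := (if `[< D c y >] then 0 else n c) * a y.
have h : \sum_(y <- F) \sum_(d <- L) t d y *~ b d y = 0.
  rewrite -[RHS]Fa; apply: eq_bigr => y _; rewrite E mulrz_suml.
  by apply: eq_bigr => d _; rewrite mulrzA.
have := t_indep2 uL uF h cL xF; rewrite /b; case: asboolP => // _ na.
by move: (mulf_neq0 nc ax); rewrite na eqxx.
Qed.

(** If some generator with countably many prescribed coordinates occurs, the
    relations are supported in a countable set: away from the prescribed
    coordinates D0 the coordinates are independent, so a relation is determined
    by its part on D0, for which there are countably many possibilities. *)
Lemma relations_countable : countable (D c0) ->
  exists2 D', countable D' & relations_within (comb L n) D'.
Proof.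
move=> cD0; set g := comb L n.
pose D0 := \bigcup_(c in [set c | c \in L /\ countable (D c)]) D c.
have cD : countable D0.
  apply: bigcup_countable => [|c []//].
  apply: (@sub_countable _ _ _ [set` L]); last exact/finite_set_countable/finite_seq.
  by apply: subset_card_le => c [].
pose b c x := if `[< D c x >] then 0 else n c.
have gE x : ~ D0 x -> g x = \sum_(c <- L) t c x *~ b c x.
  move=> nD0; rewrite /g combE; apply: eq_big_seq => d dL.
  rewrite /gen /b; case: asboolP => // Dx.
  have [cd|[_ ->//]] := D_type d; last by rewrite mul0rz mulr0z.
  by case: nD0; exists d.
have b0 x : ~ D0 x -> b c0 x = n c0.
  by move=> nD; rewrite /b; case: asboolP => // Dx; case: nD; exists c0.
have [f finj] : exists f : I -> nat, {in D0 &, injective f}.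
  by move/countable_injP: cD.
(* a finite part of a relation, supported in D0 *)
pose val_ (s : seq (I * int)) := \sum_(p <- s) g p.1 *~ p.2.
pose S := [set s : seq (I * int) | forall p, p \in s -> D0 p.1].
have cS : countable S.
  apply: card_le_trans (countableP [set: seq (nat * int)]).
  apply: (@card_le_fun _ _ _ _ (map (fun p => (f p.1, p.2)))) => //.
  elim=> [|p s IH] [|q s'] //= Ss Ss' [] fpq pq ss'.
  congr cons; last first.
    by apply: IH => // r rs; [apply: Ss|apply: Ss']; rewrite inE rs orbT.
  rewrite [p]surjective_pairing [q]surjective_pairing pq; congr pair.
  by apply: finj => //; rewrite inE; [apply: Ss|apply: Ss']; rewrite inE eqxx.
pose rel_ s (F : seq I) (a : I -> int) := [/\ uniq F,
  forall x, x \in F -> ~ D0 x & \sum_(x <- F) g x *~ a x = - val_ s].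
pose X s := [set x | exists F a, [/\ rel_ s F a, x \in F & a x != 0]].
exists (D0 `|` \bigcup_(s in S) X s).
  apply: countableU => //; apply: bigcup_countable => // s _.
  have [[F1 [a1 r1]]|nX] := pselect (exists F a, rel_ s F a); last first.
    suff -> : X s = set0 by exact: countable0.
    by rewrite -subset0 => x [F [a [r _ _]]]; apply: nX; exists F, a.
  apply: (@sub_countable _ _ _ [set` F1]); last exact/finite_set_countable/finite_seq.
  apply: subset_card_le => x [F2 [a2 [r2 xF2 ax]]] /=.
  have [uF1 nF1 E1] := r1; have [uF2 nF2 E2] := r2.
  apply/negPn/negP => xF1.
  pose G := undup (F1 ++ F2); have uG : uniq G by apply: undup_uniq.
  have nG y : y \in G -> ~ D0 y.
    by rewrite mem_undup mem_cat => /orP[/nF1|/nF2].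
  have xG : x \in G by rewrite mem_undup mem_cat xF2 orbT.
  pose d y := (if y \in F2 then a2 y else 0) - (if y \in F1 then a1 y else 0).
  have h : \sum_(y <- G) \sum_(c <- L) t c y *~ (b c y * d y) = 0.
    transitivity (\sum_(y <- G) g y *~ d y).
      apply: eq_big_seq => y yG; rewrite gE; last exact: nG.
      by rewrite mulrz_suml; apply: eq_bigr => c _; rewrite mulrzA.
    rewrite (eq_bigr (fun y => g y *~ (if y \in F2 then a2 y else 0) -
       g y *~ (if y \in F1 then a1 y else 0))); last by move=> y _; rewrite mulrzBr.
    rewrite sumrB -big_seq_extend //; last first.
      by move=> y yF; rewrite mem_undup mem_cat yF orbT.
    rewrite -big_seq_extend //; last by move=> y yF; rewrite mem_undup mem_cat yF.
    by rewrite E1 E2 subrr.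
  have := t_indep2 uL uG h c0L xG; rewrite b0; last exact: nG.
  rewrite /d xF2 (negPf xF1) subr0 => na.
  by move: (mulf_neq0 nc0 ax); rewrite na eqxx.
move=> F a uF Fa x xF ax.
have [D0x|nD0x] := pselect (D0 x); first by left.
right; exists [seq (y, a y) | y <- F & `[< D0 y >]].
  by move=> _ /mapP[y /[!mem_filter] /andP[/asboolP ? _] ->].
exists [seq y <- F | ~~ `[< D0 y >]], a; split=> //.
  split; first exact: filter_uniq.
    by move=> y; rewrite mem_filter => /andP[/asboolP].
  apply/eqP; rewrite -subr_eq0 opprK /val_ big_map !big_filter /= addrC.
  by rewrite -[X in _ == X]Fa [X in _ == X](bigID (fun y => `[< D0 y >])).
by rewrite mem_filter xF andbT; apply/asboolP.
Qed.

End combination.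

(** Every nonzero element of the group either has its relations in a countable
    set, or has them in a piece on which it vanishes. *)
Lemma span_relations g : span g -> g <> 0 ->
  (exists2 D', countable D' & relations_within g D') \/
  exists A, [/\ PP A, relations_within g A & forall x, A x -> g x = 0].
Proof.
move=> [L [n [uL ->]]] g0.
have [[c0 [c0L nc0 cD]]|nc] :=
    pselect (exists c, [/\ c \in L, n c != 0 & countable (D c)]).
  by left; apply: relations_countable c0L nc0 cD.
have [c0 [c0L nc0]] : exists c, c \in L /\ n c != 0.
  apply: contrapT => h; apply: g0; rewrite /comb big1_seq // => c /= cL.
  have [->|nc'] := eqVneq (n c) 0; first by rewrite mulr0z.
  by case: h; exists c.
have LP c : c \in L -> n c != 0 -> PP (D c) /\ forall x, D c x -> phi c x = 0.
  by move=> cL nc1; have [cd|//] := D_type c; case: nc; exists c.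
have rel := relations_pieces uL LP.
have [allD|nD] := pselect (forall c, c \in L -> n c != 0 -> D c = D c0).
  right; exists (D c0); split; first by have [] := LP c0 c0L nc0.
    move=> F a uF Fa x xF ax; exact: (rel F a uF Fa x xF ax c0).
  move=> x Dx; rewrite combE big1_seq // => c /= cL.
  have [->|nc1] := eqVneq (n c) 0; first by rewrite mulr0z.
  have Dcx : D c x by rewrite allD.
  rewrite /gen; case: asboolP => // _.
  by rewrite (LP c cL nc1).2 // mul0rz.
left; exists set0; first exact: countable0.
move=> F a uF Fa x xF ax; have h := rel F a uF Fa x xF ax.
apply: nD => c cL nc1; apply: (@PP_disjoint _ _ x).
- exact: (LP c cL nc1).1.
- exact: (LP c0 c0L nc0).1.
- exact: h.
- exact: h.
Qed.

Hypothesis I_uncountable : ~ countable [set: I].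
Hypothesis PP_proper : forall A, PP A -> A <> setT.

(** The generators are independent. *)
Lemma comb_eq0 L n : uniq L -> comb L n = 0 -> {in L, forall c, n c = 0}.
Proof.
move=> uL g0 c0 c0L; apply: contrapT => /eqP nc0.
have vanish D' : relations_within (comb L n) D' -> D' = setT.
  move=> rel; apply/seteqP; split=> // x _.
  have := rel [:: x] (fun=> 1) isT _ x _ _; apply.
  - by rewrite big_seq1 g0.
  - by rewrite inE.
  - by [].
have [[c [cL nc cD]]|nc] :=
    pselect (exists c, [/\ c \in L, n c != 0 & countable (D c)]).
  have [D' cD' /vanish D'T] := relations_countable uL cL nc cD.
  by apply: I_uncountable; rewrite -D'T.
have LP c : c \in L -> n c != 0 -> PP (D c) /\ forall x, D c x -> phi c x = 0.
  by move=> cL nc1; have [cd|//] := D_type c; case: nc; exists c.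
have /vanish E := relations_pieces uL LP.
apply: (PP_proper (LP c0 c0L nc0).1); apply/seteqP; split=> // x _.
have : [set: I] x by []; rewrite -E; exact.
Qed.

End generators.

(** * Quotients of subgroups of a power of the torus *)

Section subgroups.
Variables (R : realType) (I : choiceType) (H : zmodClosed (torus_power R I)).
Local Notation T := (torus R).
Local Notation P := (torus_power R I).
Local Notation K := (subgroup_type H).
Implicit Types (f g h z : K) (F : seq I) (e : R).

Lemma subvalB g h x : val (g - h) x = val g x - val h x.
Proof. by rewrite raddfB. Qed.

Lemma subvalMz g (n : int) : val (g *~ n) = val g *~ n.
Proof. by rewrite raddfMz. Qed.

Lemma sub_nbhsP f (A : set K) : nbhs f A <->
  exists F e, 0 < e /\
    forall g, {in F, forall x, small e (val g x - val f x)} -> A g.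
Proof.
split.
  move=> [_ [[B oB <-] Bf] BA].
  have /power_nbhsP[F [e [e0 FB]]] : nbhs (val f) B by apply: open_nbhs_nbhs.
  by exists F, e; split=> // g /FB; apply: BA.
move=> [F [e [e0 FA]]].
have cv : continuous (val : K -> P) := @initial_continuous _ _ _.
pose S := [set p : P | {in F, forall x, small e (p x - val f x)}].
have nS : nbhs (val f) S by apply/power_nbhsP; exists F, e.
by apply: (@filterS _ (nbhs f) _ (val @^-1` S)) (cv f S nS) => g /FA.
Qed.

(** The closure of N contains every point that vanishes on D. *)
Definition dense_off (N : set K) (D : set I) := forall p : P,
  (forall x, D x -> p x = 0) -> forall F e, 0 < e ->
  exists2 z, N z & {in F, forall x, small e (val z x - p x)}.

Section quotient.
Variable N : zmodClosed K.
Local Notation Q := (quotient_group N).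

(** The canonical projection onto the quotient. *)
Definition qpi g : Q := (\pi_(Quotient.quot N) g)%qT.

Lemma qpi_eqP g h : qpi g = qpi h <-> g - h \in N.
Proof. by rewrite Quotient.idealrBE; split=> [E|/eqP E]; [apply/eqP|]; exact: E. Qed.

Lemma qpi_repr (q : Q) : qpi (repr (q : Quotient.quot N)) = q.
Proof. exact: reprK. Qed.

Lemma repr_qpi (q : Q) x : (forall z, z \in N -> val z x = 0) ->
  forall g, qpi g = q -> val (repr (q : Quotient.quot N)) x = val g x.
Proof.
move=> Nx g gq; have /qpi_eqP/Nx : qpi g = qpi (repr (q : Quotient.quot N)).
  by rewrite qpi_repr.
by rewrite subvalB => /eqP; rewrite subr_eq0 => /eqP.
Qed.

Lemma qopenP (U : set Q) : open U <-> forall g, U (qpi g) ->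
  exists F e, 0 < e /\
    forall h, {in F, forall x, small e (val h x - val g x)} -> U (qpi h).
Proof.
have E : open U <-> open (qpi @^-1` U) by [].
rewrite E openE; split=> h g /h; last by move=> ?; apply/sub_nbhsP.
by move=> /sub_nbhsP.
Qed.

Lemma quotient_T1 (q : Q) : closed [set` N] -> open (~` [set q]).
Proof.
move=> cN; apply/qopenP => g gq.
pose r : K := repr (q : Quotient.quot N).
have rN : ~ (g - r \in N).
  by move=> /qpi_eqP; rewrite qpi_repr.
have /sub_nbhsP[F [e [e0 h]]] : nbhs (g - r) (~` [set` N]).
  by apply: open_nbhs_nbhs; split=> //; apply: closed_openC.
exists F, e; split=> // k kF kq; apply: (h (k - r)).
  by move=> x xF; rewrite !subvalB opprB addrA subrK; apply: kF.
by apply/qpi_eqP; rewrite qpi_repr.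
Qed.

Lemma basis_infinite (B : set (set Q)) : closed [set` N] ->
  infinite_set [set: Q] -> basis B -> infinite_set B.
Proof.
move=> cN Qinf [Bo Bn] Bfin; apply: Qinf.
have B1 (q : Q) : B [set q].
  pose O := ~` \bigcup_(V in [set V | B V /\ V q]) ~` V.
  have oO : open O.
    apply: closed_openC; apply: closed_bigcup => [|V [/Bo oV _]].
      by apply: sub_finite_set Bfin => V [].
    exact: open_closedC.
  have Oq : O q by move=> [V [_ Vq]].
  have Osub y : O y -> y = q.
    move=> Oy; apply: contrapT => yq.
    have /Bn[V [BV Vq] /(_ y)] : nbhs q (~` [set y]).
      apply: open_nbhs_nbhs; split; first exact: quotient_T1.
      by move=> /= qy; apply: yq.
    by move=> Vy; apply: Oy; exists V => // /Vy; apply.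
  have /Bn[V [BV Vq] VO] : nbhs q O by apply: open_nbhs_nbhs.
  suff <- : V = [set q] by [].
  by apply/seteqP; split=> [y /VO/Osub//|_ ->].
apply: card_le_finite Bfin; apply: (card_le_fun (f := fun q : Q => [set q])) => //.
by move=> x y _ _ /seteqP[/(_ x erefl)].
Qed.

(** A base of the quotient: basic open sets of the coordinates in D suffice,
    because the remaining ones can be adjusted within N. *)
Lemma quotient_basis (D : set I) : dense_off [set` N] D ->
  exists2 B : set (set Q), basis B &
    B #<= [set s : seq (I * (rat * nat)) | {in s, forall p, D p.1}].
Proof.
move=> Ndense.
pose Ks (s : seq (I * (rat * nat))) : set K := [set g |
  {in s, forall p, small p.2.2.+1%:R^-1 (val g p.1 - tpi (ratr p.2.1))}].
have Ksopen s g : Ks s g -> exists F e, 0 < e /\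
    forall h, {in F, forall x, small e (val h x - val g x)} -> Ks s h.
  elim: s => [|p s IH] gs; first by exists [::], 1; split=> // h _ q.
  have [|F [e [e0 he]]] := IH; first by move=> q qs; apply: gs; rewrite inE qs orbT.
  have /torus_openP/(_ (val g p.1))[] :=
      @small_open R p.2.2.+1%:R^-1 (tpi (ratr p.2.1)).
    by apply: gs; rewrite inE eqxx.
  move=> d d0 hd; exists (p.1 :: F), (Num.min d e); rewrite lt_min d0; split=> //.
  move=> h hF q; rewrite inE => /predU1P[->|qs].
    rewrite -[val h p.1](subrK (val g p.1)) [_ + val g _]addrC; apply: hd.
    apply: smallW (hF _ _); last by rewrite inE eqxx.
    by rewrite ge_min lexx.
  apply: he => // x xF; apply: smallW (hF _ _); last by rewrite inE xF orbT.
  by rewrite ge_min lexx orbT.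
pose W s := [set qpi g | g in Ks s].
exists (W @` [set s | {in s, forall p, D p.1}]); last exact: card_image_le.
split.
  move=> _ [s sD <-]; apply/qopenP => g [g' g's /esym/qpi_eqP gN].
  have [F [e [e0 he]]] := Ksopen s g' g's.
  exists F, e; split=> // h hF; exists (h - (g - g')).
    apply: he => x xF.
    by rewrite !subvalB opprB addrCA [X in X - _]addrC addrK; apply: hF.
  by apply/qpi_eqP; rewrite addrAC subrr sub0r rpredN.
move=> q A; rewrite nbhsE => -[O [/qopenP oO Oq] OA].
pose g : K := repr (q : Quotient.quot N).
have gq : qpi g = q := qpi_repr q.
have [|F [e [e0 he]]] := oO g; first by rewrite gq.
have e4 : 0 < e / 4 by rewrite divr_gt0.
pose n := Num.bound (e / 4)^-1.
have ne : n.+1%:R^-1 <= e / 4.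
  rewrite invf_ple ?posrE ?ltr0n // ltW //.
  apply: lt_trans (archi_boundP _) _; first by rewrite invr_ge0 ltW.
  by rewrite ltr_nat.
have /choice[a aP] : forall x, exists a : rat,
    small n.+1%:R^-1 (val g x - tpi (ratr a)).
  move=> x; have [r _ ->] := tpi_surj (val g x).
  have lt_r : r - n.+1%:R^-1 < r by rewrite ltrBlDr ltrDl invr_gt0 ltr0n.
  have [a] := rat_in_itvoo lt_r; rewrite in_itv /= => /andP[a1 a2].
  exists a; rewrite -tpiB; exists (r - ratr a) => //.
  by rewrite gtr0_norm ?subr_gt0 // ltrBlDr addrC -ltrBlDr.
pose s := [seq (x, (a x, n)) | x <- F & `[< D x >]].
have sD : {in s, forall p, D p.1}.
  by move=> _ /mapP[x /[!mem_filter] /andP[/asboolP Dx _] ->].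
exists (W s).
  split; first by exists s.
  by exists g => // _ /mapP[x _ ->]; apply: aP.
move=> _ [g' g's <-]; apply: OA.
pose p : P := fun x => if `[< D x >] then 0 else val g x - val g' x.
have pD x : D x -> p x = 0 by move=> Dx; rewrite /p; case: asboolP.
have e2 : 0 < e / 2 by rewrite divr_gt0.
have [z zN zp] := Ndense p pD F _ e2.
have -> : qpi g' = qpi (g' + z).
  by apply/qpi_eqP; rewrite opprD addrA subrr sub0r rpredN.
apply: he => x xF; have := zp x xF.
have -> : val (g' + z) x - val g x = (val g' x - val g x) + val z x.
  by rewrite addrAC.
rewrite /p; case: asboolP => [Dx|_ h]; last first.
  apply: smallW (_ : e / 2 <= e) _; first by lra.
  by move: h; rewrite opprB addrC.
rewrite subr0 => zx; rewrite [e]splitr; apply: smallD => //.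
have /g's /= h : (x, (a x, n)) \in s.
  by apply/mapP; exists x => //; rewrite mem_filter xF andbT; apply/asboolP.
apply: smallW (_ : n.+1%:R^-1 + n.+1%:R^-1 <= e / 2) _.
  by move: ne; set c := n.+1%:R^-1 => ne; lra.
rewrite -[val g' x](subrK (tpi (ratr (a x)))) -addrA; apply: smallD => //.
by rewrite -opprB; apply: smallN; apply: aP.
Qed.

(** If N vanishes on D and the elements of K take arbitrary values on finite
    sets, then a basic neighbourhood of zero constrains finitely many
    coordinates, whence as many basic sets as elements of D. *)
Lemma card_le_basis (D : set I) (B : set (set Q)) :
    ~ countable D -> (forall z x, z \in N -> D x -> val z x = 0) ->
    (forall (p : P) F, exists k : K, {in F, forall x, val k x = p x}) ->
  basis B -> D #<= B.
Proof.
move=> Dunc ND Krich [Bo Bn].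
pose U x : set Q := [set q | small 4^-1 (val (repr (q : Quotient.quot N)) x)].
have Ux x g : D x -> U x (qpi g) <-> small 4^-1 (val g x).
  by move=> Dx; rewrite /U /= (@repr_qpi (qpi g) x _ g) // => z /ND; apply.
have /choice[FV FVP] : forall V : set Q, exists F : seq I, B V -> V (qpi 0) ->
    forall g, {in F, forall x, val g x = 0} -> V (qpi g).
  move=> V; have [[BV V0]|nV] := pselect (B V /\ V (qpi 0)); last first.
    by exists [::] => BV V0; case: nV.
  have /qopenP/(_ 0 V0)[F [e [e0 h]]] := Bo _ BV.
  exists F => _ _ g gF; apply: h => x /gF ->.
  by rewrite subr0; apply: small0.
have DB : D #<= B `*` [set: nat].
  apply: (@card_le_rel _ _ _ _ (fun x Vi =>
    x \in FV Vi.1 /\ Vi.2 = index x (FV Vi.1))); last first.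
    move=> x x' [V i] /= _ _ [xF ->] [x'F ii].
    by rewrite -(nth_index x xF) ii nth_index.
  move=> x Dx.
  have /Bn[V [BV V0] VU] : nbhs (qpi 0) (U x).
    apply: open_nbhs_nbhs; split; last first.
      by apply/Ux => //; apply: small0; rewrite invr_gt0.
    apply/qopenP => g /(Ux x g Dx) gx.
    have /torus_openP/(_ (val g x))[] := @small_open R 4^-1 0.
      by rewrite /= subr0.
    move=> e e0 he; exists [:: x], e; split=> // h hx; apply/Ux => //.
    rewrite -[val h x](subrK (val g x)) addrC -[X in small _ X]subr0.
    by apply: he; apply: hx; rewrite inE.
  exists (V, index x (FV V)) => //; split=> //=.
  apply/negPn/negP => xF.
  have [k kF] := Krich (fun y => if y == x then tpi 2^-1 else 0) (x :: FV V).
  have : V (qpi k).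
    apply: FVP => // y yF; rewrite kF ?inE ?yF ?orbT //.
    by case: eqVneq => // yx; move: xF; rewrite -yx yF.
  by move=> /VU/Ux -/(_ Dx); rewrite kF ?inE ?eqxx // => /half_not_small.
have Binf : infinite_set B.
  move=> Bfin; apply: Dunc; apply: card_le_trans DB _.
  by apply: countableX; [exact: finite_set_countable|exact: countableP].
exact: card_le_trans DB (card_setX_nat_le Binf).
Qed.

(** A quotient that keeps a coordinate free is infinite. *)
Lemma quotient_infinite x : (forall z, z \in N -> val z x = 0) ->
    (forall (p : P) F, exists k : K, {in F, forall x, val k x = p x}) ->
  infinite_set [set: Q].
Proof.
move=> Nx Krich; apply/infiniteP.
apply: (@card_le_rel _ _ _ _ (fun (n : nat) (q : Q) =>
  val (repr (q : Quotient.quot N)) x = tpi n.+2%:R^-1)).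
  move=> n _; have [k kx] := Krich (fun=> tpi n.+2%:R^-1) [:: x].
  exists (qpi k) => //; rewrite (repr_qpi Nx erefl) kx // inE //.
move=> n m q _ _ -> /tpi_eqP[k kE].
have inv01 (i : nat) : 0 < (i.+2%:R^-1 : R) < 1.
  by rewrite invr_gt0 ltr0n invf_plt ?posrE ?ltr0n // invr1 ltr1n.
have /andP[n0 n1] := inv01 n; have /andP[m0 m1] := inv01 m.
move: n0 n1 m0 m1 kE; set u := n.+2%:R^-1; set v := m.+2%:R^-1.
move=> u0 u1 v0 v1 kE; have k0 : k = 0.
  have [k1|k1|//] := ltrgt0P k.
    have : 1 <= k%:~R :> R by rewrite -[1]/(1%:~R) ler_int.
    by move=> k1'; exfalso; lra.
  have : k%:~R <= -1 :> R by rewrite -[-1]/((-1)%:~R) ler_int -ltzD1.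
  by move=> k1'; exfalso; lra.
move: kE; rewrite k0 addr0 /u /v => /invr_inj /eqP.
by rewrite eqr_nat => /eqP[].
Qed.

End quotient.
End subgroups.

(** * Weights, pseudocompactness and monotheticity *)

Lemma has_weight_uniq (X : topologicalType) U V (k : set U) (l : set V) :
  has_weight X k -> has_weight X l -> k #= l.
Proof.
move=> [[B bB Bk] hk] [[B' bB' B'l] hl]; rewrite card_eq_le; apply/andP; split.
  by rewrite -(card_le_eqr B'l); apply: hk.
by rewrite -(card_le_eqr Bk); apply: hl.
Qed.

Lemma has_weight_eq (X : topologicalType) U V (k : set U) (l : set V) :
  k #= l -> has_weight X k -> has_weight X l.
Proof.
move=> kl [[B bB Bk] hk]; split.
  by exists B => //; apply: card_eq_trans Bk kl.
by move=> B' /hk; rewrite (card_le_eql kl).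
Qed.

Section subgroup_properties.
Variables (R : realType) (I : choiceType) (H : zmodClosed (torus_power R I)).
Local Notation T := (torus R).
Local Notation P := (torus_power R I).
Local Notation K := (subgroup_type H).
Implicit Types (f g h z : K) (F : seq I) (e : R) (N : zmodClosed K) (D A : set I).

(** K projects onto every countable subproduct. *)
Definition countably_full := forall D (p : P), countable D ->
  exists k : K, forall x, D x -> val k x = p x.

(** A sequence along which f is unbounded would cluster, on the countably many
    coordinates that control it, at a point of K. *)
Lemma countably_full_pseudocompact : countably_full -> pseudocompact R K.
Proof.
move=> full f fc; apply: contrapT => nb.
have /choice[g gP] : forall n : nat, exists x : K, n%:R < `|f x|.
  move=> n; apply: contrapT => ng; apply: nb; exists n%:R => x.
  by rewrite leNgt; apply/negP => fx; apply: ng; exists x.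
have /choice[Fn FnP] : forall n : nat, exists F, forall h,
    {in F, forall x, val h x = val (g n) x} -> n%:R < `|f h|.
  move=> n.
  have /sub_nbhsP[F [e [e0 h]]] : nbhs (g n) (f @^-1` [set y | n%:R < `|y|]).
    apply: fc; apply/nbhs_ballP; exists (`|f (g n)| - n%:R).
      by rewrite /= subr_gt0.
    move=> y; rewrite /ball /= => gy.
    have : `|f (g n)| <= `|y| + `|f (g n) - y|.
      by rewrite -{1}[f (g n)](subrK y) addrC ler_normD.
    by move: gy; lra.
  exists F => k kF; apply: h => x /kF ->; rewrite subrr; exact: small0.
pose D := \bigcup_(n in [set: nat]) [set` Fn n].
have cD : countable D.
  by apply: bigcup_countable => // n _; apply/finite_set_countable/finite_seq.
have [y ycl] := power_cluster (fun n => val (g n)).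
have [h hy] := full D y cD.
have /sub_nbhsP[F [e [e0 hF]]] : nbhs h (f @^-1` ball (f h) 1).
  by apply: fc; apply: nbhsx_ballx.
have [n Nn gn] := ycl F e (Num.bound (`|f h| + 1)) e0.
pose p : P := fun x => if `[< D x >] then val (g n) x else val h x.
have [k kp] := full (D `|` [set` F]) p
  (countableU cD (finite_set_countable (finite_seq F))).
have kn : n%:R < `|f k|.
  apply: FnP => x xF; have Dx : D x by exists n.
  by rewrite kp ?/p; [case: asboolP|left].
have : ball (f h) 1 (f k).
  apply: hF => x xF; rewrite kp; last by right.
  rewrite /p; case: asboolP => [Dx|_]; last by rewrite subrr; apply: small0.
  by rewrite hy //; apply: gn.
rewrite /ball /= => hk.
have h1 : `|f k| <= `|f h| + `|f h - f k|.
  by rewrite -{1}[f k](subKr (f h)) ler_normB.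
have : `|f h| + 1 < n%:R.
  apply: lt_le_trans (archi_boundP _) _; first by rewrite addr_ge0.
  by rewrite ler_nat.
by lra.
Qed.

Lemma relations_dense_off N g D : g \in N ->
  relations_within (val g) D -> dense_off [set` N] D.
Proof.
move=> gN rel p pD F e e0; have [n nF] := kronecker F rel pD e0.
exists (g *~ n); first by rewrite /= rpredMz.
by move=> x xF; rewrite subvalMz power_mulrz; apply: nF.
Qed.

Lemma independent_monothetic g : relations_within (val g) set0 -> monothetic K.
Proof.
move=> rel; exists g => O [o Oo] oO.
have /sub_nbhsP[F [e [e0 h]]] : nbhs o O by apply: open_nbhs_nbhs.
have [n nF] := @kronecker _ _ _ set0 (val o) F e rel (fun x => False_ind _) e0.
exists (g *~ n); split; last by exists n.
by apply: h => x xF; rewrite subvalMz power_mulrz; apply: nF.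
Qed.

Lemma dense_off_mem N D h : closed [set` N] -> dense_off [set` N] D ->
  (forall x, D x -> val h x = 0) -> h \in N.
Proof.
move=> cN dN hD; apply: cN => B /sub_nbhsP[F [e [e0 hB]]].
have [z zN zF] := dN (val h) hD F e e0.
by exists z; split=> //; apply: hB.
Qed.

(** The points that vanish on D and those that vanish on D' generate the whole
    power when D and D' are disjoint. *)
Lemma dense_off_disjoint N D D' : (forall x, D x -> ~ D' x) ->
  dense_off [set` N] D -> dense_off [set` N] D' -> dense_off [set` N] set0.
Proof.
move=> DD' dN dN' p _ F e e0; have e2 : 0 < e / 2 by rewrite divr_gt0.
pose p1 : P := fun x => if `[< D x >] then 0 else p x.
have [|z1 z1N z1F] := dN p1 _ F _ e2.
  by move=> x Dx; rewrite /p1; case: asboolP.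
have [|z2 z2N z2F] := dN' (fun x => p x - p1 x) _ F _ e2.
  move=> x D'x; rewrite /p1; case: asboolP => [/DD'//|_]; exact: subrr.
exists (z1 + z2); first exact: rpredD.
move=> x xF; rewrite [e]splitr.
have -> : val (z1 + z2) x - p x = (val z1 x - p1 x) + (val z2 x - (p x - p1 x)).
  by rewrite opprB addrA [_ + (p1 x - _)]addrA [val z1 x - p1 x + _]addrAC subrK.
by apply: smallD; [apply: z1F|apply: z2F].
Qed.

(** The subgroup of the points of K that vanish on A. *)
Definition annihilator A : set K := [set h | forall x, A x -> val h x = 0].

Lemma ex_annihilator A : exists2 N : zmodClosed K, [set` N] = annihilator A & closed [set` N].
Proof.
have [||N NE] := @ex_zmodClosed K (annihilator A).
- by [].
- by move=> f g fA gA x Ax; rewrite subvalB fA // gA // subrr.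
exists N => //; rewrite NE => h hcl x Ax; apply: small_eq0 => e e0.
have [|z [zA /= zh]] := hcl [set z | small e (val z x - val h x)].
  apply/sub_nbhsP; exists [:: x], e; split=> // k; apply.
  by rewrite inE.
by move: zh; rewrite zA // sub0r => /smallN; rewrite opprK.
Qed.

Section full.
Hypothesis full : countably_full.

Lemma finitely_full (p : P) F : exists k : K, {in F, forall x, val k x = p x}.
Proof.
have [k kF] := full p (finite_set_countable (finite_seq F)).
by exists k => x /kF.
Qed.

Lemma annihilator_dense_off D : countable D -> dense_off (annihilator D) D.
Proof.
move=> cD p pD F e e0.
have [k kp] := full p (countableU cD (finite_set_countable (finite_seq F))).
exists k; first by move=> x Dx; rewrite kp ?pD //; left.
by move=> x xF; rewrite kp ?subrr; [apply: small0|right].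
Qed.

Lemma countable_quotient_basis N D : countable D -> dense_off [set` N] D ->
  exists2 B : set (set (quotient_group N)), basis B & countable B.
Proof.
move=> cD /quotient_basis[B bB Bs]; exists B => //.
apply: card_le_trans Bs _.
have [f [_ finj]] := card_le_funP 0%N cD.
apply: card_le_trans (countableP [set: seq (nat * (rat * nat))]).
apply: (@card_le_fun _ _ _ _ (map (fun p => (f p.1, p.2)))) => //.
elim=> [|p s IH] [|q s'] //= Ss Ss' [] fpq pq ss'.
congr cons; last first.
  by apply: IH => // r rs; [apply: Ss|apply: Ss']; rewrite inE rs orbT.
rewrite [p]surjective_pairing [q]surjective_pairing pq; congr pair.
by apply: finj => //; [apply: Ss|apply: Ss']; rewrite inE eqxx.
Qed.

Lemma countable_weight N D : closed [set` N] -> countable D ->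
    dense_off [set` N] D -> infinite_set [set: quotient_group N] ->
  has_weight (quotient_group N) [set: nat].
Proof.
move=> cN cD dN Qinf; split; last first.
  by move=> B bB; apply/infiniteP; apply: basis_infinite bB.
have [B bB cB] := countable_quotient_basis cD dN; exists B => //.
rewrite card_eq_le; apply/andP; split => //.
by apply/infiniteP; apply: basis_infinite bB.
Qed.

(** The lower bound uses that K is full, the upper one that N is dense among the
    points that vanish on A. *)
Lemma uncountable_weight N A : ~ countable A -> dense_off [set` N] A ->
    (forall z x, z \in N -> A x -> val z x = 0) ->
  has_weight (quotient_group N) A.
Proof.
move=> Aunc dN NA.
have le (B : set (set (quotient_group N))) : basis B -> A #<= B.
  exact: (card_le_basis Aunc NA finitely_full).
split; last exact: le.
have [B bB Bs] := quotient_basis dN; exists B => //.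
rewrite card_eq_le; apply/andP; split; last exact: le.
have Ainf : infinite_set A by move=> /finite_set_countable.
have E : [set s : seq (I * (rat * nat)) | {in s, forall p, A p.1}] #<=
    A `*` [set: rat * nat].
  have -> : [set s : seq (I * (rat * nat)) | {in s, forall p, A p.1}] =
      [set s : seq (I * (rat * nat)) | {in s, forall p, (A `*` setT) p}].
    by apply/seteqP; split=> s h p /h //; case.
  apply: card_seq_le => Afin; apply: Ainf.
  apply: card_le_finite Afin.
  by apply: (card_le_fun (f := fun x => (x, (0, 0%N)))) => // x y _ _ [].
apply: card_le_trans Bs _; apply: card_le_trans E _.
apply: card_le_trans (card_setX_nat_le Ainf).
by apply: card_le_setX => //; apply: countableP.
Qed.

End full.
End subgroup_properties.

(** * The closed subgroups of the generated group *)

Section generated.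
Variables (R : realType) (I : choiceType).
Local Notation T := (torus R).
Local Notation P := (torus_power R I).
Variable t : I -> I -> T.
Hypothesis t_indep : forall (F : seq (I * I)) a, uniq F ->
  \sum_(p <- F) t p.1 p.2 *~ a p = 0 -> {in F, forall p, a p = 0}.
Variables (D : I -> set I) (phi : I -> P) (PP : set (set I)).
Hypothesis D_type : forall c,
  countable (D c) \/ PP (D c) /\ forall x, D c x -> phi c x = 0.
Hypothesis D_full : forall D' (p : P), countable D' ->
  exists c, D' `<=` D c /\ forall x, D' x -> phi c x = p x.
Hypothesis D_set0 : exists c, D c = set0.
Hypothesis D_piece : forall A, PP A ->
  exists2 c, D c = A & forall x, A x -> phi c x = 0.
Hypothesis PP_disjoint : forall A B x, PP A -> PP B -> A x -> B x -> A = B.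
Hypothesis I_uncountable : ~ countable [set: I].
Hypothesis PP_proper : forall A, PP A -> A <> setT.
Variable H : zmodClosed P.
Hypothesis HE : [set` H] = span t D phi.
Local Notation K := (subgroup_type H).
Local Notation gn := (gen t D phi).

Let gen_in c : gn c \in H.
Proof. by have : [set` H] (gn c) by rewrite HE; apply: span_gen. Qed.

(** The generators as elements of the subgroup. *)
Definition sgen c : K := exist _ (gn c) (gen_in c).

Let in_span (k : K) : span t D phi (val k).
Proof. by rewrite -HE; apply: (valP k). Qed.

Let val_neq0 (k : K) : k <> 0 -> val k <> 0.
Proof. by move=> k0 vk; apply: k0; apply: val_inj. Qed.

Lemma span_countably_full : countably_full H.
Proof.
move=> D' p cD; have [c [DD phic]] := D_full p cD.
exists (sgen c) => x Dx; rewrite /= /gen.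
by case: asboolP => [_|[]]; [apply: phic|apply: DD].
Qed.

Lemma span_monothetic : monothetic K.
Proof.
have [c Dc] := D_set0; apply: (@independent_monothetic _ _ _ (sgen c)).
move=> F a uF Fa x xF ax.
have h : \sum_(y <- F) \sum_(d <- [:: c]) t d y *~ a y = 0.
  rewrite -[RHS]Fa; apply: eq_bigr => y _; rewrite big_seq1 /= /gen.
  by rewrite Dc; case: asboolP.
have c1 : c \in [:: c] by rewrite inE.
have := t_indep2 t_indep (L := [:: c]) (b := fun _ y => a y) isT uF h c1 xF.
by move/eqP: ax.
Qed.

Lemma sgen_relations c A : D c = A -> PP A -> (forall x, A x -> phi c x = 0) ->
  relations_within (val (sgen c)) A.
Proof.
move=> Dc PA phi0.
have -> : val (sgen c) = comb t D phi [:: c] (fun=> 1) by rewrite /comb big_seq1.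
move=> F a uF Fa x xF ax.
have : [set x | forall d, d \in [:: c] -> (1 : int) != 0 -> D d x] x.
  apply: (relations_pieces t_indep (L := [:: c]) (n := fun=> 1) _ _ uF Fa) => //.
  by move=> d; rewrite inE => /eqP -> _; rewrite Dc.
by move/(_ c); rewrite Dc; apply=> //; rewrite inE.
Qed.

Lemma closed_subgroup_cases (N : zmodClosed K) : closed [set` N] ->
    [set` N] <> [set 0] ->
  (exists2 D', countable D' & dense_off [set` N] D') \/
  exists A, [/\ PP A, dense_off [set` N] A & [set` N] = annihilator A].
Proof.
move=> cN N0.
have [[D' cD dN]|nD] :=
    pselect (exists2 D', countable D' & dense_off [set` N] D').
  by left; exists D'.
right; have [g gN g0] : exists2 g : K, g \in N & g <> 0.
  apply: contrapT => ng; apply: N0; apply/seteqP; split=> [g gN|_ ->].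
    by apply: contrapT => g0; apply: ng; exists g.
  exact: rpred0.
have cases (z : K) : z \in N -> z <> 0 -> exists A,
    [/\ PP A, dense_off [set` N] A & forall x, A x -> val z x = 0].
  move=> zN z0.
  have [[D' cD rel]|[A [PA rel zA]]] := span_relations t_indep D_type PP_disjoint
      (in_span z) (val_neq0 z0).
    by case: nD; exists D' => //; apply: relations_dense_off rel.
  by exists A; split=> //; apply: relations_dense_off rel.
have [A [PA dA _]] := cases g gN g0; exists A; split=> //.
apply/seteqP; split=> [z zN x Ax|h hA]; last exact: dense_off_mem dA hA.
have [->//|/eqP z0] := eqVneq z 0.
have [B [PB dB zB]] := cases z zN z0.
have [AB|AB] := pselect (forall y, A y -> ~ B y).
  case: nD; exists set0; first exact: countable0.
  exact: dense_off_disjoint dA dB.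
apply: zB; suff -> : B = A by [].
have [y Ay By] : exists2 y, A y & B y.
  by apply: contrapT => h; apply: AB => y Ay By; apply: h; exists y.
exact: PP_disjoint By Ay.
Qed.

Lemma annihilator_piece_dense_off A : PP A ->
  dense_off (annihilator (H := H) A) A.
Proof.
move=> PA; have [c Dc phi0] := D_piece PA.
have [N NE _] := ex_annihilator H A; rewrite -NE.
apply: (@relations_dense_off _ _ _ _ (sgen c)); last exact: sgen_relations.
have : [set` N] (sgen c) by rewrite NE => x Ax; rewrite /= /gen;
  case: asboolP => [_|[]]; [apply: phi0|rewrite Dc].
by [].
Qed.

Lemma annihilator_inj A B : PP A -> PP B -> B !=set0 ->
  annihilator (H := H) A = annihilator B -> A = B.
Proof.
move=> PA PB [x Bx] AB; have [c Dc phi0] := D_piece PA.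
have gA : annihilator A (sgen c).
  move=> y Ay; rewrite /= /gen.
  by case: asboolP => [_|[]]; [apply: phi0|rewrite Dc].
apply: (@PP_disjoint _ _ x) => //.
apply: (sgen_relations Dc PA phi0 (F := [:: x]) (a := fun=> 1)) => //.
  by rewrite big_seq1; rewrite AB in gA; rewrite gA.
by rewrite inE.
Qed.

Lemma sgen_inj : injective sgen.
Proof.
move=> c d /(congr1 val) /= cd; apply: contrapT => /eqP ncd.
have u : uniq [:: c; d] by rewrite /= inE ncd.
pose n x : int := if x == c then 1 else -1.
have := comb_eq0 t_indep D_type I_uncountable PP_proper (n := n) u.
have -> : comb t D phi [:: c; d] n = 0.
  rewrite /comb !big_cons big_nil addr0 /n eqxx eq_sym (negPf ncd).
  by rewrite cd mulrNz mulr1z subrr.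
by move=> /(_ erefl c); rewrite /n inE eqxx => /(_ isT).
Qed.

Lemma span_free : free_abelian K.
Proof.
exists (range sgen).
pose good (c : K -> int) := finite_set [set b | c b != 0] /\
  [set b | c b != 0] `<=` range sgen.
(* the sum over the basis as a sum over a sequence of indices *)
have sumE c : good c -> exists L, [/\ uniq L,
    forall i, i \notin L -> c (sgen i) = 0 &
    val (\sum_(b \in range sgen) b *~ c b) = comb t D phi L (c \o sgen)].
  move=> [/finite_seqP[s0 s0E] sub].
  pose s := undup s0; have us : uniq s := undup_uniq _.
  have sE b : (b \in s) = (c b != 0).
    rewrite mem_undup; apply/idP/idP => h.
      by have : [set b | c b != 0] b by rewrite s0E.
    by have : [set` s0] b by rewrite -s0E.
  have [L LE] : exists L, s = map sgen L.
    have {}sub b : b \in s -> range sgen b by rewrite sE => /sub.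
    elim: s {us sE} sub => [|b s IH] sub; first by exists [::].
    have [|L ->] := IH; first by move=> d ds; apply: sub; rewrite inE ds orbT.
    have [|i _ <-] := sub b; first by rewrite inE eqxx.
    by exists (i :: L).
  exists L; split.
  - by move: us; rewrite LE => /map_uniq.
  - move=> i iL; apply/eqP; apply: contraNT iL => ci.
    have : sgen i \in s by rewrite sE.
    by rewrite LE mem_map //; apply: sgen_inj.
  - rewrite -(@fsbig_widen _ _ _ _ [set` s]).
    + rewrite -fsbig_seq // LE big_map raddf_sum; apply: eq_bigr => i _.
      exact: subvalMz (sgen i) _.
    + by move=> b /=; rewrite sE => /sub.
    + by move=> b [_ /=]; rewrite sE => /negP/negPn/eqP ->; rewrite mulr0z.
move=> k; have [L [n [uL kE]]] := in_span k.
pose c b : int := if pselect (exists2 i, i \in L & b = sgen i) is left e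
  then n (s2val (cid2 e)) else 0.
have cL i : i \in L -> c (sgen i) = n i.
  move=> iL; rewrite /c; case: pselect => [e|[]]; last by exists i.
  by case: (cid2 e) => j jL ij /=; rewrite (sgen_inj ij).
have cN b : (forall i, i \in L -> b <> sgen i) -> c b = 0.
  by move=> h; rewrite /c; case: pselect => // e; exfalso; case: e => i iL; exact: h.
have goodc : good c.
  have sub b : c b != 0 -> exists2 i, i \in L & b = sgen i.
    move=> cb; apply: contrapT => h; move/eqP: cb; apply; apply: cN => i iL bi.
    by apply: h; exists i.
  split; last by move=> b /sub[i _ ->]; exists i.
  apply: (@sub_finite_set _ _ [set` map sgen L]); last exact: finite_seq.
  by move=> b /sub[i iL ->] /=; apply: map_f.
have ext L1 L2 (c' : I -> int) : uniq L1 -> uniq L2 -> {subset L1 <= L2} ->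
    (forall i, i \notin L1 -> c' i = 0) -> comb t D phi L1 c' = comb t D phi L2 c'.
  move=> u1 u2 s12 h; rewrite /comb (big_seq_extend _ _ u1 u2 s12).
  apply: eq_bigr => i _; case: ifP => // /negbT/h ->; exact: mulr0z.
pose union (L1 L2 : seq I) := undup (L1 ++ L2).
have uU L1 L2 : uniq (union L1 L2) by apply: undup_uniq.
have sU1 L1 L2 : {subset L1 <= union L1 L2}.
  by move=> i iL; rewrite mem_undup mem_cat iL.
have sU2 L1 L2 : {subset L2 <= union L1 L2}.
  by move=> i iL; rewrite mem_undup mem_cat iL orbT.
have [L1 [u1 h1 E1]] := sumE c goodc.
have kE1 : val k = comb t D phi L1 (c \o sgen).
  rewrite kE (ext L1 (union L1 L)) // -(ext L (union L1 L)) //.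
    by apply: eq_big_seq => i /cL <-.
  by move=> i iL; apply: cN => j jL /sgen_inj ij; move: iL; rewrite ij jL.
exists c; split.
  by split; [exact: goodc.1|exact: goodc.2|apply: val_inj; rewrite E1].
move=> c' [fin' sub' kE'].
have [L2 [u2 h2 E2]] := sumE c' (conj fin' sub').
have E0 : comb t D phi (union L1 L2) (fun i => c (sgen i) - c' (sgen i)) = 0.
  transitivity (comb t D phi (union L1 L2) (c \o sgen) -
      comb t D phi (union L1 L2) (c' \o sgen)).
    by rewrite /comb -sumrB; apply: eq_bigr => i _; rewrite mulrzBr.
  have <- := ext _ _ (c \o sgen) u1 (uU L1 L2) (sU1 L1 L2) h1.
  have <- := ext _ _ (c' \o sgen) u2 (uU L1 L2) (sU2 L1 L2) h2.
  by rewrite -kE1 -E2 -kE' subrr.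
apply/funext => b; have [[i _ <-]|nb] := pselect (range sgen b); last first.
  have [/eqP ->|/goodc.2//] := boolP (c b == 0).
  by have [/eqP ->|/sub'//] := boolP (c' b == 0).
have [iG|] := boolP (i \in union L1 L2).
  apply/eqP; rewrite -subr_eq0; apply/eqP.
  exact: (comb_eq0 t_indep D_type I_uncountable PP_proper (uU L1 L2) E0 iG).
by rewrite mem_undup mem_cat negb_or => /andP[/h1 /= -> /h2 /= ->].
Qed.

End generated.

(** * Coding by the Cantor space *)

Local Notation cantor := (nat -> bool).

Lemma cantor_uncountable : ~ countable [set: cantor].
Proof.
move=> /(card_le_funP 0%N)[f [_ finj]].
pose d n := `[< exists x : cantor, f x = n /\ x n = false >].
case dd : (d (f d)).
  have /asboolP[x [fx]] : d (f d) by rewrite dd.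
  by rewrite (finj x d) // dd.
have : d (f d) by apply/asboolP; exists d.
by rewrite dd.
Qed.

Lemma cantor_infinite : infinite_set [set: cantor].
Proof. by move=> /finite_set_countable/cantor_uncountable. Qed.

Lemma card_seq_cantor : [set: nat -> cantor] #<= [set: cantor].
Proof.
pose code (f : nat -> cantor) : cantor := fun n =>
  if unpickle n is Some (i, j) then f i j else false.
apply: (card_le_fun (f := code)) => // f g _ _ fg.
apply/funext => i; apply/funext => j.
by have := congr1 (fun h => h (pickle (i, j))) fg; rewrite /code pickleK.
Qed.

Lemma card_torus_cantor (R : realType) : [set: torus R] #<= [set: cantor].
Proof.
apply: (@card_le_rel _ _ _ _ (fun t (x : cantor) => exists2 r : R, t = tpi r &
  forall q : rat, x (pickle q) = (ratr q < r))).
  move=> t _; have [r _ ->] := tpi_surj t.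
  exists (fun n => if unpickle n is Some q then ratr q < r else false) => //.
  by exists r => // q; rewrite pickleK.
move=> _ _ x _ _ [r -> rx] [s -> sx]; congr tpi.
have H (a b : R) : (forall q : rat, (ratr q < a) = (ratr q < b)) -> b <= a.
  move=> h; rewrite leNgt; apply/negP => ab.
  have [q] := rat_in_itvoo ab; rewrite in_itv /= => /andP[aq qb].
  by have := h q; rewrite qb ltNge (ltW aq).
by apply/eqP; rewrite eq_le; apply/andP; split; apply: H => q; rewrite -rx -sx.
Qed.

Lemma card_setX_cantor T U (A : set T) (B : set U) :
  A #<= [set: cantor] -> B #<= [set: cantor] -> A `*` B #<= [set: cantor].
Proof.
move=> hA hB; apply: card_le_trans (card_le_setX hA hB) _.
exact: card_setX_le cantor_infinite.
Qed.

Lemma card_seq_cantor_le T : [set: T] #<= [set: cantor] ->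
  [set: nat -> T] #<= [set: cantor].
Proof.
move=> /(card_le_funP (fun=> false))[f [_ finj]].
apply: card_le_trans card_seq_cantor.
apply: (card_le_fun (f := fun s n => f (s n))) => // s s' _ _ ss.
by apply/funext => n; apply: finj => //; have := congr1 (fun h => h n) ss.
Qed.

(** A set embedded in the Cantor space is parametrized by it. *)
Lemma cantor_surj T (A : set T) (x0 : T) : A #<= [set: cantor] ->
  exists s : cantor -> T, (forall c, s c = x0 \/ A (s c)) /\
    forall x, A x -> exists c, s c = x.
Proof.
move=> /(card_le_funP (fun=> false))[f [_ finj]].
have /choice[s sP] : forall c, exists x,
    (x = x0 \/ A x) /\ forall y, A y -> f y = c -> x = y.
  move=> c; have [[y Ay fy]|ny] := pselect (exists2 y, A y & f y = c).
    exists y; split; first by right.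
    by move=> z Az fz; apply: finj => //; rewrite fy fz.
  by exists x0; split; [left|move=> y Ay fy; case: ny; exists y].
exists s; split=> [c|x Ax]; first by case: (sP c).
by exists (f x); apply: (sP (f x)).2.
Qed.

Section construction.
Variables (R : realType) (PP : set (set cantor)).
Local Notation P := (torus_power R cantor).
Hypothesis PP_disjoint : forall A B x, PP A -> PP B -> A x -> B x -> A = B.
Hypothesis PP_neq0 : forall A, PP A -> A !=set0.

(** The family of prescribed coordinates: all functions on countable sets, and
    the zero function on the pieces and on the empty set. *)
Lemma ex_prescriptions : exists (D : cantor -> set cantor) (phi : cantor -> P),
  [/\ forall c, countable (D c) \/ PP (D c) /\ forall x, D c x -> phi c x = 0,
      forall D' (p : P), countable D' ->
        exists c, D' `<=` D c /\ forall x, D' x -> phi c x = p x,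
      exists c, D c = set0 &
      forall A, PP A -> exists2 c, D c = A & forall x, A x -> phi c x = 0].
Proof.
have PPle : PP #<= [set: cantor].
  apply: (@card_le_rel _ _ _ _ (fun (A : set cantor) x => PP A /\ A x)).
    by move=> A PA; have [x Ax] := PP_neq0 PA; exists x.
  by move=> A B x _ _ [PA Ax] [PB Bx]; apply: PP_disjoint Ax Bx.
pose X1 := ((nat -> cantor) * (nat -> torus R))%type.
have X1le : [set: X1] #<= [set: cantor].
  rewrite -setXTT; apply: card_setX_cantor; first exact: card_seq_cantor.
  exact: card_seq_cantor_le (card_torus_cantor R).
have natle : [set: nat] #<= [set: cantor] by apply/infiniteP/cantor_infinite.
have [s1 [_ s1s]] := cantor_surj ((fun=> fun=> false, fun=> 0) : X1) X1le.
have [s2 [s2P s2s]] := cantor_surj set0 PPle.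
have [s0 [_ s0s]] := cantor_surj (0%N, fun=> false)
  (card_setX_cantor natle (card_lexx [set: cantor])).
have {}s0s b c : exists d, s0 d = (b, c) by apply: s0s.
pose D c := match (s0 c).1 with
  | 0%N => range (s1 (s0 c).2).1 | 1%N => s2 (s0 c).2 | _ => set0 end.
pose phi c : P := fun x => if (s0 c).1 is 0%N then
    (s1 (s0 c).2).2 (xget 0%N [set n | (s1 (s0 c).2).1 n = x]) else 0.
exists D, phi; split.
- move=> c; rewrite /D /phi; case: (s0 c).1 => [|[|_]].
  + by left; apply: card_image_le.
  + by have [->|PA] := s2P (s0 c).2; [left; apply: countable0|right].
  + by left; apply: countable0.
- move=> D' p cD.
  have [e eD] : exists e : nat -> cantor, D' `<=` range e.
    have [f [_ finj]] := card_le_funP 0%N cD.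
    have /choice[e eP] : forall n, exists x, forall y, D' y -> f y = n -> x = y.
      move=> n; have [[y Dy fy]|ny] := pselect (exists2 y, D' y & f y = n).
        by exists y => z Dz fz; apply: finj => //; rewrite fy fz.
      by exists (fun=> false) => y Dy fy; case: ny; exists y.
    by exists e => x Dx; exists (f x) => //; apply: eP.
  have [c1 c1E] := s1s (e, p \o e) I; have [c cE] := s0s 0%N c1.
  exists c; rewrite /D /phi cE /= c1E /=; split=> // x /eD[n _ nx].
  have : [set n | e n = x] (xget 0%N [set n | e n = x]).
    by apply: xgetPex; exists n.
  by move=> /= ->.
- have [c cE] := s0s 2%N (fun=> false).
  by exists c; rewrite /D cE.
- move=> A PA; have [c1 c1E] := s2s A PA; have [c cE] := s0s 1%N c1.
  by exists c; rewrite /D /phi cE.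
Qed.

(** Independent elements of the torus indexed by pairs. *)
Lemma ex_independent_pairs : exists t : cantor -> cantor -> torus R,
  forall (F : seq (cantor * cantor)) a, uniq F ->
  \sum_(p <- F) t p.1 p.2 *~ a p = 0 -> {in F, forall p, a p = 0}.
Proof.
have [t0 t0P] := independent_family R.
have /(card_le_funP (fun=> false))[f [_ finj]] := card_setTX_le cantor_infinite.
have {}finj : injective f by move=> p q; apply: finj.
have /choice[g gf] : forall y, exists q, forall p, f p = y -> q = p.
  move=> y; have [[q qy]|nq] := pselect (exists q, f q = y).
    by exists q => p py; apply: finj; rewrite py.
  by exists (fun=> false, fun=> false) => p py; case: nq; exists p.
exists (fun c x => t0 (f (c, x))) => F a uF Fa p pF; apply/eqP/negPn/negP => ap.
apply: (t0P (map f F) (fun y => a (g y)) _ _ (f p)).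
- by rewrite map_inj_uniq.
- rewrite big_map -[RHS]Fa; apply: eq_bigr => q _.
  by rewrite (gf _ q) // -surjective_pairing.
- exact: map_f.
- by rewrite (gf _ p).
Qed.

Hypothesis PP_proper : forall A, PP A -> A <> setT.

(** A free monothetic group, full over countable sets of coordinates, whose
    nontrivial closed subgroups are the annihilators of the pieces and subgroups
    that contain, up to closure, all points vanishing on some countable set. *)
Theorem ex_group_of_pieces : exists H : zmodClosed P,
  [/\ countably_full H, monothetic (subgroup_type H),
      free_abelian (subgroup_type H),
      forall N : zmodClosed (subgroup_type H),
        closed [set` N] -> [set` N] <> [set 0] ->
        (exists2 D, countable D & dense_off [set` N] D) \/
        exists A, [/\ PP A, dense_off [set` N] A & [set` N] = annihilator A] &
      forall A, PP A -> dense_off (annihilator (H := H) A) A /\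
        forall B, PP B -> annihilator (H := H) A = annihilator B -> A = B].
Proof.
have [t t_indep] := ex_independent_pairs.
have [D [phi [D_type D_full D_set0 D_piece]]] := ex_prescriptions.
have [H HE] := ex_zmodClosed (span0 t D phi) (@spanB _ _ t D phi).
exists H; split.
- exact (span_countably_full D_full HE).
- exact (span_monothetic t_indep D_set0 HE).
- exact (span_free t_indep D_type cantor_uncountable PP_proper HE).
- exact (closed_subgroup_cases t_indep D_type PP_disjoint HE).
- move=> A PA; split; first exact (annihilator_piece_dense_off t_indep D_piece HE PA).
  move=> B PB; exact (annihilator_inj t_indep D_piece PP_disjoint HE PA PB (PP_neq0 PB)).
Qed.

End construction.

(** * Prescribed weights and numbers of quotients *)

Section pieces.
Variables (U V : Type) (E : set (set U)) (mu : set U -> set V).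
Hypotheses (E_neq : forall a b, E a -> E b -> a #= b -> a = b)
  (E_le : forall a, E a -> a #<= continuum)
  (mu_le : forall a, E a -> mu a #<= continuum).

(** Disjoint pieces of the Cantor space, mu a many of them equipotent to a, for
    each a in E. *)
Lemma ex_pieces : exists piece : set U -> V -> set cantor,
  [/\ forall a v, E a -> mu a v -> piece a v #= a,
      forall a v b w x, E a -> E b -> mu a v -> mu b w ->
        piece a v x -> piece b w x -> a = b /\ v = w &
      forall a v, piece a v <> setT].
Proof.
pose c0 : cantor := fun=> false.
have El : E #<= [set: cantor].
  by apply: card_le_nonequipotent => //; exact: cantor_infinite.
have [fE [_ fEinj]] := card_le_funP c0 El.
have /choice[i iP] : forall a, exists f : U -> cantor, E a ->
    forall x y, a x -> a y -> f x = f y -> x = y.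
  move=> a; have [Ea|nE] := pselect (E a); last by exists (fun=> c0).
  by have [f [_ finj]] := card_le_funP c0 (E_le Ea); exists f.
have /choice[m mP] : forall a, exists f : V -> cantor, E a ->
    forall x y, mu a x -> mu a y -> f x = f y -> x = y.
  move=> a; have [Ea|nE] := pselect (E a); last by exists (fun=> c0).
  by have [f [_ finj]] := card_le_funP c0 (mu_le Ea); exists f.
have /(card_le_funP c0)[f [_ finj]] := card_setTX_le cantor_infinite.
have {}finj : injective f by move=> p q; apply: finj.
(* the leading coordinate leaves room outside of the pieces *)
pose pr (x y z w : cantor) := f (f (x, y), f (z, w)).
have prinj x y z w x' y' z' w' : pr x y z w = pr x' y' z' w' ->
    [/\ x = x', y = y', z = z' & w = w'].
  by move=> /finj[/finj[-> ->] /finj[-> ->]].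
exists (fun a v => (fun u => pr c0 (fE a) (m a v) (i a u)) @` a); split.
- move=> a v Ea mv; apply: inj_card_eq => u w; rewrite !inE => au aw.
  by move=> /prinj[_ _ _]; apply: iP.
- move=> a v b w x Ea Eb mv mw [u au <-] [u' bu' /prinj[_ ab vw _]].
  have E' : a = b by apply: fEinj.
  by split=> //; apply: (mP b) => //; [rewrite -E'|rewrite vw E'].
- move=> a v aT; have : [set: cantor] (pr (fun=> true) c0 c0 c0) by [].
  by rewrite -aT => -[u _ /prinj[/(congr1 (fun h => h 0%N))]].
Qed.

End pieces.

Theorem theorem3p11 (R : realType) (U V : Type)
    (E : set (set U)) (mu : set U -> set V)
    (E_neq : forall a b, E a -> E b -> a #= b -> a = b)
    (E_nonempty : E !=set0)
    (E_bounds : forall a, E a -> [set: nat] #<= a /\ a #<= continuum)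
    (omega_notin_E : forall a, E a -> ~ (a #= [set: nat]))
    (mu_bounds : forall a, E a -> mu a !=set0 /\ mu a #<= continuum)
    (E_mu : [set: unit] #< E \/
            exists a, E = [set a] /\ [set: unit] #< mu a) :
  exists K : zmodClosed (torus_power R (nat -> bool)),
    [/\ monothetic (subgroup_type K),
        pseudocompact R (subgroup_type K),
        free_abelian (subgroup_type K),
        forall (W : Type) (k : set W),
          QW (subgroup_type K) k <->
          (k #= [set: nat] \/ exists2 a, E a & k #= a)
      & forall a, E a ->
          proper_quotients_of_weight (subgroup_type K) a #= mu a].
Proof.
have E_unc a : E a -> ~ countable a.
  move=> Ea ca; apply: (omega_notin_E a Ea); rewrite card_eq_le.
  by apply/andP; split=> //; case: (E_bounds a Ea).
have [piece [piece_card piece_inj piece_proper]] := ex_pieces E_neq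
  (fun a Ea => (E_bounds a Ea).2) (fun a Ea => (mu_bounds a Ea).2).
pose PP : set (set (nat -> bool)) := [set A | exists a v, [/\ E a, mu a v & A = piece a v]].
have piece_unc a v : E a -> mu a v -> ~ countable (piece a v).
  move=> Ea mv; rewrite (eq_countable (piece_card a v Ea mv)); exact: E_unc.
have piece_neq0 a v : E a -> mu a v -> piece a v !=set0.
  move=> Ea mv; apply: infinite_setN0 => /finite_set_countable.
  exact: piece_unc.
have PP_disjoint A B x : PP A -> PP B -> A x -> B x -> A = B.
  move=> [a [v [Ea mv ->]]] [b [w [Eb mw ->]]] Ax Bx.
  by have [-> ->] := piece_inj a v b w x Ea Eb mv mw Ax Bx.
have PP_neq0 A : PP A -> A !=set0.
  by move=> [a [v [Ea mv ->]]]; apply: piece_neq0.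
have PP_proper A : PP A -> A <> setT by move=> [a [v [_ _ ->]]].
have [H [full mono free cases ann]] :=
  ex_group_of_pieces R PP_disjoint PP_neq0 PP_proper.
have PPpiece a v : E a -> mu a v -> PP (piece a v) by exists a, v.
(* the annihilator of a set that misses a point is not trivial *)
have ann_neq0 (N : zmodClosed (subgroup_type H)) A x : ~ A x ->
    dense_off (annihilator (H := H) A) A -> [set` N] = annihilator A ->
    [set` N] <> [set 0].
  move=> nAx dA NE N0.
  pose p : torus_power R (nat -> bool) :=
    fun y => if y == x then tpi 2^-1 else 0.
  have pA y : A y -> p y = 0.
    by move=> Ay; rewrite /p; case: eqVneq => // yx; case: nAx; rewrite -yx.
  have [|z zA zx] := dA p pA [:: x] 4^-1; first by rewrite invr_gt0.
  have : [set` N] z by rewrite NE.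
  rewrite N0 => z0; apply: (@half_not_small R).
  have /zx : x \in [:: x] by rewrite inE.
  by rewrite z0 /p eqxx sub0r => /smallN; rewrite opprK.
have ann_piece_neq0 a v (N : zmodClosed (subgroup_type H)) : E a -> mu a v ->
    [set` N] = annihilator (piece a v) -> [set` N] <> [set 0].
  move=> Ea mv NE; have [x nx] : exists x, ~ piece a v x.
    apply/existsNP => h; apply: (piece_proper a v).
    by apply/seteqP; split=> // x _; apply: h.
  apply: (ann_neq0 N _ x nx _ NE).
  by have [] := ann _ (PPpiece a v Ea mv).
have weight_piece a v (N : zmodClosed (subgroup_type H)) : E a -> mu a v ->
    [set` N] = annihilator (piece a v) -> has_weight (quotient_group N) a.
  move=> Ea mv NE; apply: has_weight_eq (piece_card a v Ea mv) _.
  apply: uncountable_weight => //; first exact: piece_unc.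
    by rewrite NE; have [] := ann _ (PPpiece a v Ea mv).
  by move=> z x zN; have : [set` N] z by []; rewrite NE; apply.
have ann_infinite (N : zmodClosed (subgroup_type H)) A : A !=set0 ->
    [set` N] = annihilator A -> infinite_set [set: quotient_group N].
  move=> [x Ax] NE; apply: (@quotient_infinite _ _ _ N x).
    by move=> z zN; have : [set` N] z by []; rewrite NE; apply.
  exact: finitely_full.
exists H; split=> //; first exact: countably_full_pseudocompact.
- move=> W k; split.
  + move=> [N [[cN N0] Qinf wk]].
    have [[D cD dD]|[A [[a [v [Ea mv ->]]] _ NE]]] := cases N cN N0.
      by left; apply: has_weight_uniq wk (countable_weight cN cD dD Qinf).
    by right; exists a => //; apply: has_weight_uniq wk (weight_piece a v N Ea mv NE).
  + move=> [kn|[a Ea ka]].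
      pose D : set (nat -> bool) := [set (fun=> false)].
      have cD : countable D by apply: countable1.
      have [N NE cN] := ex_annihilator H D.
      have dD : dense_off (annihilator (H := H) D) D by apply: annihilator_dense_off.
      have Qinf : infinite_set [set: quotient_group N].
        by apply: (ann_infinite N D) => //; exists (fun=> false).
      exists N; split=> //.
        split=> //; apply: (ann_neq0 N D (fun=> true)) => //.
        by move=> /(congr1 (fun h => h 0%N)).
      apply: (has_weight_eq (k := [set: nat])); first by rewrite card_eq_sym.
      by apply: (countable_weight cN cD) => //; rewrite NE.
    have [[v mv] _] := mu_bounds a Ea.
    have [N NE cN] := ex_annihilator H (piece a v).
    exists N; split; [split=> //| |].
    * exact: ann_piece_neq0 Ea mv NE.
    * by apply: ann_infinite NE; apply: piece_neq0.
    * apply: (has_weight_eq (k := a)); first by rewrite card_eq_sym.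
      exact: weight_piece Ea mv NE.
- move=> a Ea.
  have -> : proper_quotients_of_weight (subgroup_type H) a =
      (fun v => annihilator (piece a v)) @` mu a.
    apply/seteqP; split.
      move=> _ [N [[cN N0] wa] <-].
      have [[D cD dD]|[A [[b [v [Eb mv ->]]] _ NE]]] := cases N cN N0.
        have [B bB cB] := countable_quotient_basis cD dD.
        case: (E_unc a Ea); apply: card_le_trans cB.
        exact: wa.2.
      have ab : a = b.
        apply: E_neq => //; apply: has_weight_uniq wa _.
        exact: weight_piece Eb mv NE.
      by exists v; rewrite ?NE ab.
    move=> _ [v mv <-].
    have [N NE cN] := ex_annihilator H (piece a v).
    exists N => //; split; last exact: weight_piece Ea mv NE.
    by split=> //; apply: ann_piece_neq0 Ea mv NE.
  apply: inj_card_eq => v w; rewrite !inE => mv mw /= vw.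
  have [_ /(_ _ (PPpiece a w Ea mw) vw) E1] := ann _ (PPpiece a v Ea mv).
  have [x px] := piece_neq0 a v Ea mv.
  by have [] := piece_inj a v a w x Ea Ea mv mw px; rewrite -?E1.
Qed.
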